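(* Let $n\ge2$. For every compact $K\subset\mathbb R^n$ there exists a constant $C=C(K,n)$ such that for every $g\in h^1(\mathbb R^n)\cap M^{1,n-2}(\mathbb R^n)$, $$\|g\|_{H^{-1}(K)}\le C\,\|g\|_{M^{1,n-2}(\mathbb R^n)}^{\frac12}\,\|g\|_{h^1(\mathbb R^n)}^{\frac12}.$$
   Context: Local Hardy space: fix once and for all $\phi\in C_c^\infty(B_1)$ with $\|\nabla\phi\|_{L^\infty}\le1$ and $\int\phi\neq0$, where $B_1\subset\mathbb{R}^n$ is the unit ball, and set $\phi_t(x)=t^{-n}\phi(x/t)$. A function $g\in L^1(\mathbb R^n)$ belongs to $h^1(\mathbb R^n)$ if $g_{\tilde *}(x):=\sup_{0<t<1}|\phi_t*g(x)|$ lies in $L^1(\mathbb R^n)$, with $\|g\|_{h^1(\mathbb R^n)}:=\|g_{\tilde *}\|_{L^1(\mathbb R^n)}$ (different choices of $\phi$ give equivalent norms). Morrey space: $\|g\|_{M^{1,n-2}(\mathbb R^n)}:=\sup_{x\in\mathbb R^n,\,r>0}r^{2-n}\int_{B_r(x)}|g|$, and $M^{1,n-2}(\mathbb{R}^n)$ is the set of locally integrable $g$ for which this is finite. $H^{-1}$ denotes the dual of $W^{1,2}_0$; concretely $$\|g\|_{H^{-1}(K)}:=\sup\left\{\int_K g\varphi\ :\ \varphi\in C_c^\infty(\mathbb R^n),\ \operatorname{supp}\varphi\subset K,\ \|\varphi\|_{W^{1,2}(K)}\le1\right\}.$$ *)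

(* Defs.v *)
From HB Require Import structures.
From mathcomp Require Import all_boot all_order all_algebra.
From mathcomp Require Import all_classical all_reals all_analysis.

Set Implicit Arguments.
Unset Strict Implicit.
Unset Printing Implicit Defensive.

Import Order.TTheory GRing.Theory Num.Theory.
Import numFieldNormedType.Exports.

Local Open Scope classical_set_scope.
Local Open Scope ring_scope.

(* The sigma-algebra on R^n generated by the coordinate projections, that is,
   the Borel sigma-algebra of R^n. *)
Definition measure_rV_display : measure_display.
Proof. exact: default_measure_display. Qed.

Section measurable_rV.
Context {R : realType} {n : nat}.

Definition rV_coord (i : 'I_n) (x : 'rV[R]_n) : measurableTypeR R := x ord0 i.

Let rV_set0 : g_sigma_preimage rV_coord set0.
Proof. exact: sigma_algebra0. Qed.

Let rV_setC A : g_sigma_preimage rV_coord A ->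
  g_sigma_preimage rV_coord (~` A).
Proof. exact: sigma_algebraC. Qed.

Let rV_bigcup (F : _^nat) : (forall i, g_sigma_preimage rV_coord (F i)) ->
  g_sigma_preimage rV_coord (\bigcup_i (F i)).
Proof. exact: sigma_algebra_bigcup. Qed.

HB.instance Definition _ := @isMeasurable.Build measure_rV_display
  'rV[R]_n (g_sigma_preimage rV_coord) rV_set0 rV_setC rV_bigcup.

Lemma measurable_rV_coord (i : 'I_n) :
  measurable_fun [set: 'rV[R]_n] (rV_coord i).
Proof.
move=> _ Y mY; rewrite setTI; apply: sub_sigma_algebra => /=.
rewrite -bigcup_seq/=; exists i => /=; first by rewrite mem_index_enum.
by exists Y => //; rewrite setTI.
Qed.

Lemma measurable_fun_rVP d (T : measurableType d) (f : T -> 'rV[R]_n) :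
  (forall i, measurable_fun [set: T] (rV_coord i \o f)) ->
  measurable_fun [set: T] f.
Proof.
move=> mf _ A mA; rewrite setTI.
have -> : measurable (f @^-1` A) = [set B | measurable (f @^-1` B)] A by [].
apply: (smallest_sub _ _ mA).
  split => /=.
  - by rewrite preimage_set0.
  - by move=> B mB; rewrite setTD preimage_setC; exact: measurableC.
  - by move=> F mF; rewrite preimage_bigcup; exact: bigcupT_measurable.
elim/big_ind : _ => //= [B C hB hC|i _].
  by rewrite subUset.
by move=> _ [B mB <-] /=; rewrite setTI -[X in measurable X]setTI; exact: mf.
Qed.

End measurable_rV.

Section rV_cons.
Context {R : realType} {n : nat}.

Definition rV_cons (p : measurableTypeR R * 'rV[R]_n) : 'rV[R]_n.+1 :=
  \row_i oapp (p.2 ord0) p.1 (unlift ord0 i).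

Definition rV_uncons (x : 'rV[R]_n.+1) : measurableTypeR R * 'rV[R]_n :=
  (x ord0 ord0, \row_j x ord0 (lift ord0 j)).

Lemma rV_consK : cancel rV_cons rV_uncons.
Proof.
move=> [a v]; rewrite /rV_uncons /rV_cons; congr pair.
  by rewrite mxE unlift_none.
by apply/rowP => j; rewrite !mxE liftK.
Qed.

Lemma measurable_rV_cons : measurable_fun setT rV_cons.
Proof.
apply: measurable_fun_rVP => i.
case: (unliftP ord0 i) => [j|] ->.
  rewrite (_ : _ \o _ = rV_coord j \o snd); last first.
    by apply/funext => p; rewrite /= /rV_coord mxE liftK.
  exact: (measurableT_comp (measurable_rV_coord j)).
rewrite (_ : _ \o _ = fst) //.
by apply/funext => p; rewrite /= /rV_coord mxE unlift_none.
Qed.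

Lemma measurable_rV_uncons : measurable_fun setT rV_uncons.
Proof.
apply/measurable_fun_pairP; split; first exact: measurable_rV_coord.
apply: measurable_fun_rVP => j.
rewrite (_ : _ \o _ = rV_coord (lift ord0 j)); first exact: measurable_rV_coord.
by apply/funext => x; rewrite /= /rV_coord mxE.
Qed.

End rV_cons.

(* Lebesgue measure on R^n, by induction on n: the point mass on R^0, and the
   image of the product measure under R * R^n ~ R^n.+1. *)
Section lebesgue_rV_succ.
Local Open Scope ereal_scope.
Context {R : realType} {n : nat}.
Variable mu : {sigma_finite_measure set 'rV[R]_n -> \bar R}.

Definition lebesgue_rV_succ (A : set 'rV[R]_n.+1) : \bar R :=
  pushforward (@lebesgue_measure R \x mu) rV_cons A.

Let mcons A : measurable A -> measurable (@rV_cons R n @^-1` A).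
Proof.
by move=> mA; rewrite -[X in measurable X]setTI; exact: measurable_rV_cons.
Qed.

Let succ0 : lebesgue_rV_succ set0 = 0.
Proof. by rewrite /lebesgue_rV_succ /pushforward preimage_set0 measure0. Qed.

Let succ_ge0 A : 0 <= lebesgue_rV_succ A.
Proof. by rewrite /lebesgue_rV_succ /pushforward; exact: measure_ge0. Qed.

Let succ_sigma_additive : semi_sigma_additive lebesgue_rV_succ.
Proof.
move=> F mF tF mUF; rewrite /lebesgue_rV_succ /pushforward preimage_bigcup.
apply: (@measure_semi_sigma_additive _ _ _ (@lebesgue_measure R \x mu)).
- by move=> k; exact: mcons.
- apply/trivIsetP => /= i j _ _ ij; rewrite -preimage_setI.
  by move/trivIsetP : tF => /(_ _ _ _ _ ij) ->//; rewrite preimage_set0.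
- by rewrite -preimage_bigcup; exact: mcons.
Qed.

HB.instance Definition _ := isMeasure.Build _ _ _ lebesgue_rV_succ
  succ0 succ_ge0 succ_sigma_additive.

Let succ_sigma_finite : sigma_finite setT lebesgue_rV_succ.
Proof.
have /sigma_finiteP[F [TF ndF Foo]] := sigma_finiteT (@lebesgue_measure R).
have /sigma_finiteP[G [TG ndG Goo]] := sigma_finiteT mu.
exists (fun k => @rV_uncons R n @^-1` (F k `*` G k)).
  rewrite -preimage_bigcup (_ : \bigcup_k _ = setT) ?preimage_setT //.
  rewrite -setXTT TF TG predeqE => -[x y]; split.
    by move=> [k _ []/= ? ?]; split; exists k.
  move=> [/= [k _ Fkx] [l _ Gly]]; exists (maxn k l) => //; split.
  - by move: x Fkx; exact/subsetPset/ndF/leq_maxl.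
  - by move: y Gly; exact/subsetPset/ndG/leq_maxr.
move=> k; have [? ?] := Foo k; have [? ?] := Goo k; split.
  by rewrite -[X in measurable X]setTI; apply: measurable_rV_uncons => //;
    exact: measurableX.
rewrite /lebesgue_rV_succ /pushforward -comp_preimage.
rewrite (_ : _ \o _ = id); last first.
  by apply/funext => p; exact: rV_consK.
by rewrite preimage_id product_measure1E// lte_mul_pinfty// ge0_fin_numE.
Qed.

HB.instance Definition _ := @Measure_isSigmaFinite.Build _ _ _
  lebesgue_rV_succ succ_sigma_finite.

End lebesgue_rV_succ.

Fixpoint lebesgue_rV (R : realType) (n : nat) :
    {sigma_finite_measure set 'rV[R]_n -> \bar R} :=
  match n with
  | 0%N => \d_ (0 : 'rV[R]_0)
  | m.+1 => lebesgue_rV_succ (lebesgue_rV R m)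
  end.

(* Together with sigma-additivity, this characterizes Lebesgue measure. *)
Lemma lebesgue_rV_box (R : realType) (n : nat)
    (A : 'I_n -> set (measurableTypeR R)) : (forall i, measurable (A i)) ->
  lebesgue_rV R n [set x | forall i, A i (x ord0 i)] =
  (\prod_(i < n) lebesgue_measure (A i))%E.
Proof.
elim: n A => [|n IHn] A mA.
  by rewrite big_ord0 /= diracE mem_set // => -[].
have mB m (B : 'I_m -> set (measurableTypeR R)) : (forall i, measurable (B i)) ->
    measurable [set x : 'rV[R]_m | forall i, B i (x ord0 i)].
  move=> mB.
  rewrite (_ : mkset _ = \bigcap_(i in [set: 'I_m]) (rV_coord i @^-1` B i)).
    apply: fin_bigcap_measurable => // i _.
    by rewrite -[X in measurable X]setTI; exact: measurable_rV_coord.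
  apply/seteqP; split=> x /=; first by move=> h i _; exact: h.
  by move=> h i; exact: (h i I).
rewrite big_ord_recl -IHn // -product_measure1E //; last by apply: (mB n (fun i => A (lift ord0 i))) => i; exact: mA.
rewrite /= /lebesgue_rV_succ /pushforward; congr (_ _).
apply/seteqP; split=> -[a v] /=.
  move=> h; split=> /=; first by have := h ord0; rewrite mxE unlift_none.
  by move=> i; have := h (lift ord0 i); rewrite mxE liftK.
by move=> [/= Aa Av] i; rewrite mxE; case: (unliftP ord0 i) => [j|] -> /=.
Qed.

Section euclidean_calculus.
Context {R : realType} {n : nat}.
Implicit Types (f : 'rV[R]_n -> R) (x : 'rV[R]_n).

(* The library norm on 'rV[R]_n is the sup norm. *)
Definition enorm x : R := Num.sqrt (\sum_(i < n) x ord0 i ^+ 2).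

Definition eball x (r : R) : set 'rV[R]_n := [set y | enorm (y - x) < r].

Definition partial (i : 'I_n) f : 'rV[R]_n -> R :=
  fun x => 'D_(delta_mx ord0 i) f x.

Definition grad f x : 'rV[R]_n := \row_i partial i f x.

(* All iterated partial derivatives, in any order, exist and are continuous. *)
Definition smooth f : Prop := forall s : seq 'I_n,
  let g := foldr partial f s in
  continuous g /\ forall x i, derivable g x (delta_mx ord0 i).

Definition supp f : set 'rV[R]_n := closure [set x | f x != 0].

Definition Ccinfty f : Prop := smooth f /\ compact (supp f).

End euclidean_calculus.

Section function_spaces.
Local Open Scope ereal_scope.
Context {R : realType} {n : nat}.
Implicit Types (f g phi : 'rV[R]_n -> R).

Local Notation mu := (lebesgue_rV R n).

Definition mollifier phi : Prop :=
  [/\ Ccinfty phi, supp phi `<=` eball 0%R 1%R,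
      'N[mu]_+oo[EFin \o (enorm \o grad phi)] <= 1 &
      \int[mu]_x (phi x)%:E != 0].

Definition dilate phi (t : R) : 'rV[R]_n -> R :=
  fun x => (t ^- n * phi (t^-1 *: x))%R.

Definition convolution f g (x : 'rV[R]_n) : \bar R :=
  \int[mu]_y (f (x - y)%R * g y)%:E.

Definition local_maximal phi g (x : 'rV[R]_n) : \bar R :=
  ereal_sup [set `|convolution (dilate phi t) g x|
            | t in [set t : R | (0 < t < 1)%R]].

(* The space h^1 and its norm depend on the fixed mollifier phi, the norm up to
   equivalence only. *)
Definition local_hardy phi g : Prop :=
  mu.-integrable setT (EFin \o g) /\ mu.-integrable setT (local_maximal phi g).

Definition local_hardy_norm phi g : \bar R := 'N[mu]_1[local_maximal phi g].

Definition locally_integrable_rV g : Prop :=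
  measurable_fun setT g /\
  forall K, compact K -> \int[mu]_(x in K) `|g x|%:E < +oo.

(* M^{1,n-2} *)
Definition morrey_norm g : \bar R :=
  ereal_sup [set (r ^ (2%:Z - n%:Z))%:E * \int[mu]_(y in eball x r) `|g y|%:E
            | x in [set: 'rV[R]_n] & r in [set r : R | (0 < r)%R]].

Definition morrey g : Prop := locally_integrable_rV g /\ morrey_norm g < +oo.

Definition W12_norm (K : set 'rV[R]_n) f : \bar R :=
  (\int[mu]_(x in K) (f x ^+ 2)%:E +
   \int[mu]_(x in K) (enorm (grad f x) ^+ 2)%:E) `^ 2^-1.

(* K may have empty interior, so test functions live on the whole of R^n. *)
Definition Hm1_norm (K : set 'rV[R]_n) g : \bar R :=
  ereal_sup [set \int[mu]_(x in K) (g x * f x)%:E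
            | f in [set f | [/\ Ccinfty f, supp f `<=` K & W12_norm K f <= 1]]].

End function_spaces.

(* Main.v *)
Require Import Defs.
From mathcomp Require Import all_boot all_order all_algebra.
From mathcomp Require Import all_classical all_reals all_analysis.
From mathcomp Require Import measurable_realfun.
From mathcomp Require Import ring lra.

(* With t_k = 2^-(k+1), phi_t the L^1-dilates of phi and P_t f = phi~_t * f
   (phi~ the reflection of phi), the integral of P_{t_k} P_{t_k} f * g tends to
   (int phi)^2 int f g.  Since the P_t commute, consecutive terms differ by
   int D_k (phi_{t_k} * g + phi_{t_{k+1}} * g), D_k = P_{t_{k+1}} f - P_{t_k} f.
   Here |D_k| is at most a multiple of t_k A_k |grad f|, where A_k is the average
   over cubes of size t_k, and |phi_{t_k} * g| <= b_k := min(h, c M t_k^-2), where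
   h is the local maximal function and M the Morrey norm.  Writing
   S = sum_k t_k A_k b_k and W = sum_k t_k b_k, it remains to bound the L^2 norm
   of S.  Summing the geometric series on both sides of t_k = sqrt(M/h) gives
   W^2 <= 16 c M h, so int W^2 <= 16 c M ||g||_{h^1}.  Finally A_j A_k is bounded
   by averages over cubes of size 2 t_k when t_j <= t_k, and t_{k-1} = 2 t_k, so
   with A the average over unit cubes,
   int S^2 <= C int W (S + A W) <= 1/2 int S^2 + C' int W^2; this replaces the
   maximal theorem, and the finite sums over k make int S^2 finite. *)

Set Implicit Arguments.
Unset Strict Implicit.
Unset Printing Implicit Defensive.

Import Order.TTheory GRing.Theory Num.Theory.
Import numFieldNormedType.Exports.

Local Open Scope classical_set_scope.
Local Open Scope ring_scope.

(** * Lebesgue measure on R^n *)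

(** A W^{1,2} function need not be bounded when n >= 2, so |int f g| cannot be estimated through the
    L^1 norm of g; g must be seen only through phi_t * g. This is why P_t appears squared: one
    factor is moved onto g while the other stays on f, and S^2 - T^2 = (S + T)(S - T) leaves one
    difference on f, of size t |grad f|, against one mollification of g. The two bounds in b_k have
    different origins: h is a supremum over t < 1, whereas |phi_t * g| is at most c t^-n times the
    mass of |g| in a ball of radius t, which is at most M t^(n-2). Differences start at the scale
    1/2, so the coarsest term is bounded through |f| instead of |grad f|; this is where the L^2 part
    of the W^{1,2} norm enters. The averages are transferred from |grad f| to b_k by symmetry, and
    Cauchy-Schwarz is replaced by x y <= l x^2 + y^2 / l. A choice of l of the order of sqrt(M
    ||g||_{h^1}) at the very end produces both exponents 1/2. *)

Section affine_change_of_variables.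
Context {R : realType}.
Local Notation leb := (@lebesgue_measure R).
Local Open Scope ereal_scope.

(** The image of Lebesgue measure under the affine map, multiplied by |a|, agrees with Lebesgue
    measure on half-open intervals, hence everywhere by uniqueness. For a < 0 the preimage of an
    interval is closed at the other end, which does not change its length. *)
Lemma ge0_integral_affine (a b : R) (F : R -> \bar R) :
  a != 0%R -> measurable_fun setT F -> (forall x, 0 <= F x) ->
  \int[leb]_x F (a * x + b)%R = (`|a|^-1)%:E * \int[leb]_x F x.
Proof.
move=> a0 mF F0.
pose T (x : measurableTypeR R) : measurableTypeR R := (a * x + b)%R.
have mT : measurable_fun setT T.
  by apply: measurable_funD => //; apply: measurable_funM.
have na : (0 <= `|a|)%R by [].
have Hleb (A : set (measurableTypeR R)) : measurable A ->
    leb A = mscale (NngNum na) (pushforward leb T) A.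
  apply: lebesgue_measure_unique => _ [[c d] _ <-] /=.
  rewrite /mscale /= /pushforward.
  have [a_gt0|a_lt0] : (0 < a \/ a < 0)%R.
    by case: (ltrgtP a 0%R) a0 => // ? _; [right|left].
  - rewrite (_ : T @^-1` _ = [set` `]((c - b) / a)%R, ((d - b) / a)%R]]); last first.
      apply/seteqP; split=> x /=; rewrite !in_itv /= /T => /andP[h1 h2].
        by rewrite ltr_pdivrMr // ler_pdivlMr //; apply/andP; split; lra.
      by move: h1 h2; rewrite ltr_pdivrMr // ler_pdivlMr // => *; apply/andP; split; lra.
    rewrite !lebesgue_measure_itv /= !lte_fin ltr_pM2r ?invr_gt0 // ltrD2r.
    case: ifPn => _; last by rewrite mule0.
    by rewrite -EFinD -EFinM gtr0_norm //; congr EFin; field; rewrite gt_eqF.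
  - rewrite (_ : T @^-1` _ = [set` `[((d - b) / a)%R, ((c - b) / a)%R[]); last first.
      apply/seteqP; split=> x /=; rewrite !in_itv /= /T => /andP[h1 h2].
        by rewrite ltr_ndivlMr // ler_ndivrMr //; apply/andP; split; lra.
      by move: h1 h2; rewrite ltr_ndivlMr // ler_ndivrMr // => *; apply/andP; split; lra.
    rewrite !lebesgue_measure_itv /= !lte_fin ltr_nM2r ?invr_lt0 // ltrD2r.
    case: ifPn => _; last by rewrite mule0.
    by rewrite -EFinD -EFinM ltr0_norm //; congr EFin; field; rewrite lt_eqF.
have -> : \int[leb]_x F x = `|a|%:E * \int[leb]_x F (T x).
  rewrite (eq_measure_integral (mscale (NngNum na) (pushforward leb T)))
    => [|A mA _]; last exact: Hleb.
  rewrite ge0_integral_mscale //; congr (_ * _).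
  by rewrite ge0_integral_pushforward // => y _.
by rewrite muleA -EFinM mulVf ?normr_eq0 // mul1e.
Qed.

(** One factor per coordinate: besides translations, reflections and dilations, this covers the
    intermediate points met when the coordinates are rescaled one after the other. *)
Definition dmap n (d v x : 'rV[R]_n) : 'rV[R]_n :=
  (\row_i (d ord0 i * x ord0 i + v ord0 i))%R.

Lemma measurable_dmap n (d v : 'rV[R]_n) : measurable_fun setT (dmap d v).
Proof.
apply: measurable_fun_rVP => i.
rewrite (_ : _ \o _ = fun x => d ord0 i * rV_coord i x + v ord0 i)%R; last first.
  by apply/funext => x; rewrite /= /rV_coord mxE.
apply: measurable_funD => //; apply: measurable_funM => //.
exact: measurable_rV_coord.
Qed.

Lemma dmap_cons n (d v : 'rV[R]_n.+1) p :
  dmap d v (rV_cons p) =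
  rV_cons (d ord0 ord0 * p.1 + v ord0 ord0,
    dmap (\row_j d ord0 (lift ord0 j)) (\row_j v ord0 (lift ord0 j)) p.2)%R.
Proof.
apply/rowP => i; rewrite !mxE; case: (unliftP ord0 i) => [j|] -> /=.
  by rewrite !mxE.
by [].
Qed.

Lemma ge0_integral_rV_succ n (F : 'rV[R]_n.+1 -> \bar R) :
  measurable_fun setT F -> (forall x, 0 <= F x) ->
  \int[lebesgue_rV R n.+1]_x F x =
  \int[leb]_a \int[lebesgue_rV R n]_w F (rV_cons (a, w)).
Proof.
move=> mF F0.
have mFc : measurable_fun setT (F \o @rV_cons R n).
  by apply: measurableT_comp => //; exact: measurable_rV_cons.
transitivity (\int[pushforward (leb \x lebesgue_rV R n) (@rV_cons R n)]_x F x).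
  by [].
rewrite (ge0_integral_pushforward measurable_rV_cons) // preimage_setT.
by rewrite (fubini_tonelli1 _ mFc) // => x; exact: F0.
Qed.

(** Induction on the dimension: the affine substitution in the first coordinate, the induction
    hypothesis in the others. *)
Lemma ge0_integral_dmap n (d v : 'rV[R]_n) (F : 'rV[R]_n -> \bar R) :
  (forall i, d ord0 i != 0%R) -> measurable_fun setT F -> (forall x, 0 <= F x) ->
  \int[lebesgue_rV R n]_x F (dmap d v x) =
  (\prod_(i < n) `|d ord0 i|^-1)%:E * \int[lebesgue_rV R n]_x F x.
Proof.
elim: n d v F => [|n IH] d v F d0 mF F0.
  rewrite big_ord0 mul1e; apply: eq_integral => x _; congr F.
  by apply/rowP => -[].
have mD := @measurable_dmap _ d v.
rewrite ge0_integral_rV_succ //; last exact: measurableT_comp.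
have mc a : measurable_fun setT (fun w : 'rV[R]_n => rV_cons (a, w)).
  by apply: (measurableT_comp measurable_rV_cons); apply: measurable_fun_pair.
pose G a := \int[lebesgue_rV R n]_w F (rV_cons (a, w)).
have mG : measurable_fun setT G.
  apply: (@measurable_fun_fubini_tonelli_F _ _ _ _ _ (lebesgue_rV R n)
    (F \o @rV_cons R n)) => //.
    by apply: measurableT_comp => //; exact: measurable_rV_cons.
  by move=> x; exact: F0.
have G0 a : 0 <= G a by apply: integral_ge0.
set c := (\prod_(i < n) `|d ord0 (lift ord0 i)|^-1)%R.
have c0 : (0 <= c)%R by apply: prodr_ge0 => i _.
transitivity (\int[leb]_a (c%:E * G (d ord0 ord0 * a + v ord0 ord0)%R)).
  apply: eq_integral => a _.
  under eq_integral do rewrite dmap_cons /=.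
  rewrite (IH (\row_j d ord0 (lift ord0 j))%R (\row_j v ord0 (lift ord0 j))%R
    (fun w => F (rV_cons (d ord0 ord0 * a + v ord0 ord0, w)%R))) //.
  - by under eq_bigr do rewrite mxE.
  - by move=> i; rewrite mxE.
  - exact: measurableT_comp.
rewrite ge0_integralZl_EFin //; last first.
  apply: (measurableT_comp mG).
  by apply: measurable_funD => //; apply: measurable_funM.
rewrite ge0_integral_affine // muleA -EFinM big_ord_recl mulrC.
by congr (_ * _); rewrite -ge0_integral_rV_succ.
Qed.

End affine_change_of_variables.

(** * Measurability of continuous functions on R^n *)

Section measurable_continuous.
Context {R : realType} {n : nat}.

(** The sigma-algebra is generated by the coordinates, not by the open sets. Rounding every
    coordinate down to the grid of mesh 1/(m+1) gives functions that are constant on countably many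
    measurable cells; they converge pointwise to [f] by continuity. *)
Lemma continuous_measurable_rV (f : 'rV[R]_n -> R) :
  continuous f -> measurable_fun setT f.
Proof.
move=> cf.
pose q (m : nat) (z : 'rV[int]_n) : 'rV[R]_n := \row_i ((z ord0 i)%:~R / m.+1%:R).
pose fl (m : nat) (x : 'rV[R]_n) : 'rV[int]_n := \row_i Num.floor (x ord0 i * m.+1%:R).
apply/measurable_EFinP.
apply: (@emeasurable_fun_cvg _ _ _ _ (fun m => EFin \o (f \o (q m \o fl m)))).
  move=> m; apply/measurable_EFinP => _ Y mY; rewrite setTI.
  rewrite (_ : _ @^-1` _ =
    \bigcup_(z in [set z | Y (f (q m z))]) (fl m @^-1` [set z])); last first.
    apply/seteqP; split=> x /=; first by move=> h; exists (fl m x).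
    by move=> [z /= Yz ->].
  rewrite bigcup_mkcond; apply: countable_bigcupT_measurable => [|z].
    exact: countableP.
  case: ifP => // _.
  rewrite (_ : _ @^-1` _ = \bigcap_(i in [set: 'I_n])
     (rV_coord i @^-1` [set t | Num.floor (t * m.+1%:R) = z ord0 i])).
    apply: fin_bigcap_measurable => // i _.
    rewrite -[X in measurable X]setTI; apply: measurable_rV_coord => //.
    rewrite (_ : mkset _ = `[(z ord0 i)%:~R / m.+1%:R, (z ord0 i + 1)%:~R / m.+1%:R[%classic) //.
    apply/seteqP; split=> t /=; rewrite in_itv /=.
      by move=> <-; rewrite ler_pdivrMr // ltr_pdivlMr // floor_le floorD1_gt.
    by rewrite ler_pdivrMr // ltr_pdivlMr // => h; apply: floor_def.
  apply/seteqP; split=> x /=.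
    by move=> <- i _ /=; rewrite /fl mxE.
  by move=> h; apply/rowP => i; rewrite /fl mxE; exact: (h i I).
move=> x _ /=; apply: cvg_EFin; first by apply: nearW.
apply: (@continuous_cvg _ _ _ _ _ _ f); first exact: cf.
apply/cvgrPdist_le => e e0.
near=> m; rewrite /Num.norm /= mx_normrE; apply: bigmax_le => [|[i j] _ /=]; first exact: ltW.
rewrite !mxE ord1.
have m0 : (0 : R) < m.+1%:R by [].
have h1 := floor_le (x ord0 j * m.+1%:R).
have h2 := floorD1_gt (x ord0 j * m.+1%:R).
rewrite intrD in h2.
rewrite ger0_norm; last by rewrite subr_ge0 ler_pdivrMr.
have he : m.+1%:R^-1 <= e by near: m; have [N _ hN] := near_infty_natSinv_lt (PosNum e0); exists N => // m0 /hN /ltW.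
apply: le_trans he.
rewrite -(ler_pM2r m0) mulVf ?gt_eqF // mulrBl mulfVK ?gt_eqF //.
by rewrite lerBlDl; exact: ltW.
Unshelve. all: by end_near. Qed.

End measurable_continuous.

(** * Averages over cubes *)

Section cube_averages.
Context {R : realType} {n : nat}.
Local Notation E := 'rV[R]_n.
Local Notation mu := (lebesgue_rV R n).
Local Open Scope ereal_scope.
Implicit Types (u v w : E -> \bar R) (r s : R).

Lemma measurable_addrV : measurable_fun setT (fun p : E * E => (p.1 + p.2)%R).
Proof.
apply: measurable_fun_rVP => i.
rewrite (_ : _ \o _ = fun p : E * E => (rV_coord i p.1 + rV_coord i p.2)%R).
  by apply: measurable_funD; apply: (measurableT_comp (measurable_rV_coord i)).
by apply/funext => x; rewrite /= /rV_coord mxE.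
Qed.

Lemma measurable_addrVl (a : E) : measurable_fun setT (fun x : E => (a + x)%R).
Proof.
have h : measurable_fun setT (fun x : E => (a, x)) by exact: measurable_fun_pair.
exact: (measurableT_comp measurable_addrV h).
Qed.

Lemma ge0_integral_translate (a : E) v :
  measurable_fun setT v -> (forall x, 0 <= v x) ->
  \int[mu]_x v (a + x)%R = \int[mu]_x v x.
Proof.
move=> mv v0.
rewrite -[RHS]mul1e.
have -> : 1 = (\prod_(i < n) `|(const_mx 1 : E) ord0 i|^-1)%:E :> \bar R.
  by rewrite big1 // => i _; rewrite mxE normr1 invr1.
rewrite -(@ge0_integral_dmap _ _ (const_mx 1%R) a) //; last first.
  by move=> i; rewrite mxE oner_neq0.
apply: eq_integral => x _; congr v; apply/rowP => i.
by rewrite !mxE mul1r addrC.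
Qed.

Lemma ge0_integral_opp v :
  measurable_fun setT v -> (forall x, 0 <= v x) ->
  \int[mu]_x v (- x)%R = \int[mu]_x v x.
Proof.
move=> mv v0.
rewrite -[RHS]mul1e.
have -> : 1 = (\prod_(i < n) `|(const_mx (-1) : E) ord0 i|^-1)%:E :> \bar R.
  by rewrite big1 // => i _; rewrite mxE normrN normr1 invr1.
rewrite -(@ge0_integral_dmap _ _ (const_mx (-1)%R) 0%R) //; last first.
  by move=> i; rewrite mxE oppr_eq0 oner_neq0.
apply: eq_integral => x _; congr v; apply/rowP => i.
by rewrite !mxE mulN1r addr0.
Qed.

(** Cubes rather than balls: their volume is a product, and rescaling the coordinates separately by
    factors in ]0, t] maps [cube 1] into [cube t]. *)
Definition cube r : set E := [set y | forall i, (`|y ord0 i| < r)%R].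

Lemma measurable_cube r : measurable (cube r).
Proof.
rewrite (_ : cube r = \bigcap_(i in [set: 'I_n]) (rV_coord i @^-1` [set t | `|t| < r]%R)).
  apply: fin_bigcap_measurable => // i _.
  rewrite -[X in measurable X]setTI; apply: measurable_rV_coord => //.
  rewrite (_ : mkset _ = [set` `](- r)%R, r[]) //.
  by apply/seteqP; split=> t /=; rewrite in_itv /= ltr_norml.
by apply/seteqP; split=> x /=; [move=> h i _; exact: h|move=> h i; exact: (h i I)].
Qed.
Hint Resolve measurable_cube : core.

Lemma mu_cube r : (0 <= r)%R -> mu (cube r) = ((2 * r) ^+ n)%:E.
Proof.
move=> r0.
rewrite (_ : cube r = [set x : E | forall i, [set` `](- r)%R, r[] (x ord0 i)]); last first.
  by apply/seteqP; split=> x /= h i; have := h i; rewrite in_itv /= ltr_norml.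
rewrite (lebesgue_rV_box (A := fun=> [set` `](- r)%R, r[])) //.
rewrite (eq_bigr (fun=> (2 * r)%:E)).
  elim: n => [|k IH]; first by rewrite big_ord0.
  by rewrite big_ord_recl IH -EFinM exprS.
move=> i _; rewrite lebesgue_measure_itv /= lte_fin.
case: ltP => h; first by rewrite -EFinD; congr EFin; ring.
by congr EFin; lra.
Qed.

(** The integral over the cube of half-side [r] centred at [x]; it is not divided by the volume, so
    that it is monotone in [r]. *)
Definition cubeI r v (x : E) : \bar R :=
  \int[mu]_y ((\1_(cube r) y)%:E * v (x + y)%R).

Let ind_ge0 r (y : E) : 0 <= (\1_(cube r) y)%:E :> \bar R.
Proof. by rewrite lee_fin. Qed.
Hint Resolve ind_ge0 : core.

Let mind r : measurable_fun setT (fun y : E => (\1_(cube r) y)%:E : \bar R).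
Proof. by apply/measurable_EFinP; exact: measurable_indic. Qed.
Hint Resolve mind : core.

Lemma measurable_fun_shift v : measurable_fun setT v ->
  measurable_fun setT (fun p : E * E => v (p.1 + p.2)%R).
Proof. by move=> mv; apply: (measurableT_comp mv); exact: measurable_addrV. Qed.

Let mker r v : measurable_fun setT v ->
  measurable_fun setT (fun p : E * E => (\1_(cube r) p.2)%:E * v (p.1 + p.2)%R).
Proof.
move=> mv; apply: emeasurable_funM; last exact: measurable_fun_shift.
exact: (measurableT_comp (mind r)).
Qed.

Lemma cubeI_ge0 r v x : (forall x, 0 <= v x) -> 0 <= cubeI r v x.
Proof. by move=> v0; apply: integral_ge0 => y _; apply: mule_ge0. Qed.

Lemma measurable_cubeI r v : measurable_fun setT v -> (forall x, 0 <= v x) ->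
  measurable_fun setT (cubeI r v).
Proof.
move=> mv v0; apply: (@measurable_fun_fubini_tonelli_F _ _ _ _ _ mu
  (fun p : E * E => (\1_(cube r) p.2)%:E * v (p.1 + p.2)%R)).
- exact: mker.
- by move=> p; apply: mule_ge0.
Qed.

Let mker1 r v x : measurable_fun setT v ->
  measurable_fun setT (fun y => (\1_(cube r) y)%:E * v (x + y)%R).
Proof.
move=> mv; apply: emeasurable_funM => //.
by apply: (measurableT_comp mv); exact: measurable_addrVl.
Qed.

Lemma le_cubeI r s v w x : measurable_fun setT v -> measurable_fun setT w ->
  (forall x, 0 <= v x) -> (forall x, v x <= w x) -> (r <= s)%R ->
  cubeI r v x <= cubeI s w x.
Proof.
move=> mv mw v0 vw rs; apply: ge0_le_integral => //.
- by move=> y _; apply: mule_ge0.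
- exact: mker1.
- exact: mker1.
move=> y _; apply: lee_pmul => //.
rewrite lee_fin !indicE ler_nat; case: (boolP (y \in cube r)) => // /set_mem h.
by rewrite mem_set // => i; apply: lt_le_trans (h i) rs.
Qed.

Lemma cubeIZ r v (c : R) x : measurable_fun setT v -> (forall x, 0 <= v x) ->
  (0 <= c)%R -> cubeI r (fun x => c%:E * v x) x = c%:E * cubeI r v x.
Proof.
move=> mv v0 c0; rewrite /cubeI -ge0_integralZl_EFin //.
- by apply: eq_integral => y _; rewrite muleCA.
- by move=> y _; apply: mule_ge0.
- exact: mker1.
Qed.

(** The cube is symmetric about 0, so the averaging operator is self-adjoint: Tonelli, the shift of
    x by y, Tonelli again, and the reflection of y. *)
Lemma cubeI_sym r u v : measurable_fun setT u -> (forall x, 0 <= u x) ->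
  measurable_fun setT v -> (forall x, 0 <= v x) ->
  \int[mu]_x (u x * cubeI r v x) = \int[mu]_x (cubeI r u x * v x).
Proof.
move=> mu0 u0 mv v0.
have mT : measurable_fun setT (fun p : E * E => (p.2 - p.1)%R).
  apply: measurable_fun_rVP => i.
  rewrite (_ : _ \o _ = fun p : E * E => (rV_coord i p.2 - rV_coord i p.1)%R).
    by apply: measurable_funB; apply: (measurableT_comp (measurable_rV_coord i)).
  by apply/funext => x; rewrite /= /rV_coord !mxE.
transitivity (\int[mu]_x \int[mu]_y (u x * ((\1_(cube r) y)%:E * v (x + y)%R))).
  apply: eq_integral => x _; rewrite ge0_integralZl //.
  - exact: mker1.
  - by move=> y _; apply: mule_ge0.
rewrite (fubini_tonelli (fun p : E * E => u p.1 * ((\1_(cube r) p.2)%:E * v (p.1 + p.2)%R))); last 2 first.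
- by apply: emeasurable_funM; [exact: (measurableT_comp mu0)|exact: mker].
- by move=> p; rewrite !mule_ge0.
transitivity (\int[mu]_y \int[mu]_x (u (x - y)%R * ((\1_(cube r) y)%:E * v x))).
  apply: eq_integral => y _ /=.
  rewrite -(ge0_integral_translate (- y)) /=.
  - by apply: eq_integral => x _; rewrite addrC addrNK (addrC x).
  - apply: emeasurable_funM => //; apply: emeasurable_funM => //.
    by apply: (measurableT_comp mv); under eq_fun do rewrite addrC; exact: measurable_addrVl.
  - by move=> x; rewrite !mule_ge0.
rewrite (fubini_tonelli (fun p : E * E => u (p.2 - p.1)%R * ((\1_(cube r) p.1)%:E * v p.2))); last 2 first.
- apply: emeasurable_funM; first exact: (measurableT_comp mu0).
  by apply: emeasurable_funM; [exact: (measurableT_comp (mind r))|exact: (measurableT_comp mv)].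
- by move=> p; rewrite !mule_ge0.
apply: eq_integral => x _ /=.
rewrite -ge0_integralZr //; last 2 first.
- exact: mker1.
- by move=> y _; apply: mule_ge0.
rewrite -[RHS]ge0_integral_opp; last 2 first.
- by apply: emeasurable_funM => //; exact: mker1.
- by move=> y; rewrite !mule_ge0.
apply: eq_integral => y _; rewrite muleCA muleA; congr (_ * _ * _).
rewrite !indicE; congr (_%:R%:E); congr nat_of_bool.
by apply/idP/idP => /set_mem h; apply/mem_set => i; have := h i; rewrite mxE normrN.
Qed.

Lemma integral_cube_ind r : (0 <= r)%R ->
  \int[mu]_y (\1_(cube r) y)%:E = ((2 * r) ^+ n)%:E.
Proof. by move=> r0; rewrite integral_indic // setIT; exact: mu_cube. Qed.

Lemma integral_cube_indM r (y : \bar R) : (0 <= r)%R -> 0 <= y ->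
  ((2 * r) ^+ n)%:E * y = \int[mu]_z ((\1_(cube r) z)%:E * y).
Proof.
by move=> r0 y0; rewrite -integral_cube_ind // -ge0_integralZr.
Qed.

(** For y in the small cube, x + y + [cube s] lies in x + [cube (2 * s)] because r + s <= 2 s;
    integrating over y costs the volume of the small cube. *)
Lemma cubeI_cubeI r s v x : measurable_fun setT v -> (forall x, 0 <= v x) ->
  (0 <= r)%R -> (r <= s)%R ->
  cubeI r (cubeI s v) x <= ((2 * r) ^+ n)%:E * cubeI (2 * s) v x.
Proof.
move=> mv v0 r0 rs.
rewrite (integral_cube_indM r0 (cubeI_ge0 (2 * s) x v0)).
have mI : measurable_fun setT (cubeI s v) by exact: measurable_cubeI.
have I0 z : 0 <= cubeI s v z by exact: cubeI_ge0.
apply: ge0_le_integral => //.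
- by move=> y _; apply: mule_ge0.
- exact: mker1.
- by apply: emeasurable_funM.
move=> y _; rewrite !indicE; case: (boolP (y \in cube r)) => [/set_mem hy|_]; last by rewrite !mul0e.
rewrite !mul1e.
rewrite /cubeI -(ge0_integral_translate (- y)) /=.
- apply: ge0_le_integral => //.
  + by move=> z _; apply: mule_ge0.
  + apply: emeasurable_funM.
      by apply: (measurableT_comp (mind s)); exact: measurable_addrVl.
    apply: (measurableT_comp mv); apply: (measurableT_comp (measurable_addrVl (x + y)%R)).
    exact: measurable_addrVl.
  + exact: mker1.
  move=> z _; rewrite addrA addrK; apply: lee_pmul => //.
  rewrite lee_fin !indicE ler_nat; case: (boolP (_ \in cube s)) => // /set_mem h.
  rewrite mem_set // => i; have := h i; have := hy i; rewrite !mxE => h1 h2.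
  rewrite (_ : z ord0 i = y ord0 i + (- y ord0 i + z ord0 i))%R; last by ring.
  by apply: le_lt_trans (ler_normD _ _) _; lra.
- exact: mker1.
- by move=> z; apply: mule_ge0.
Qed.

(** Symmetry moves the average over the smaller cube onto the other average, which absorbs it by
    doubling its cube. Afterwards [u] stands bare and a single average remains. *)
Lemma cubeI_pair r s u v : measurable_fun setT u -> (forall x, 0 <= u x) ->
  measurable_fun setT v -> (forall x, 0 <= v x) -> (0 <= r)%R -> (r <= s)%R ->
  \int[mu]_x (cubeI r u x * cubeI s v x) <=
  ((2 * r) ^+ n)%:E * \int[mu]_x (u x * cubeI (2 * s) v x).
Proof.
move=> mu0 u0 mv v0 r0 rs.
have mI t w : measurable_fun setT w -> (forall x, 0 <= w x) -> measurable_fun setT (cubeI t w) by exact: measurable_cubeI.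
have I0 t w z : (forall x, 0 <= w x) -> 0 <= cubeI t w z by exact: cubeI_ge0.
rewrite -cubeI_sym //; [|exact: mI|by move=> x; exact: I0].
rewrite -ge0_integralZl_EFin //.
- apply: ge0_le_integral => //.
  + by move=> x _; apply: mule_ge0 => //; apply: cubeI_ge0 => y; exact: I0.
  + by apply: emeasurable_funM => //; apply: measurable_cubeI => [|y]; [exact: mI|exact: I0].
  + by apply: emeasurable_funM => //; apply: emeasurable_funM => //; exact: mI.
  by move=> x _; rewrite muleCA; apply: lee_wpmul2l => //; apply: cubeI_cubeI.
- by move=> x _; apply: mule_ge0 => //; exact: I0.
- by apply: emeasurable_funM => //; exact: mI.
- by rewrite exprn_ge0 // mulr_ge0.
Qed.

(** Young's inequality with a free parameter, without the optimal factor 1/2. An infinite [x] or [y]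
    makes the right-hand side infinite. *)
Lemma mule_le_sqrD (l : R) (x y : \bar R) : (0 < l)%R -> 0 <= x -> 0 <= y ->
  x * y <= l%:E * (x * x) + l^-1%:E * (y * y).
Proof.
move=> l0 x0 y0.
have li0 : (0 < l^-1)%R by rewrite invr_gt0.
case: x x0 => [x|_|] //; last first.
  rewrite mulyy mulry gtr0_sg // mul1e addye ?leey //.
  by rewrite -ltNye (lt_le_trans (ltNyr 0)) // mule_ge0 ?lee_fin ?(ltW li0) // mule_ge0.
rewrite lee_fin => x0.
case: y y0 => [y|_|] //; last first.
  rewrite mulyy (mulry l^-1) gtr0_sg // mul1e addey ?leey //.
rewrite lee_fin => y0.
rewrite -!EFinM -EFinD lee_fin.
have h : (0 <= (l * x - y) ^+ 2)%R by exact: sqr_ge0.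
rewrite -(ler_pM2l l0) mulrDr !mulrA divff ?gt_eqF // mul1r.
have : (0 <= l * x * y)%R by rewrite !mulr_ge0 // ltW.
by move: h; rewrite expr2; nra.
Qed.

(** Pointwise w(x) w(x + y) <= w(x)^2 + w(x + y)^2, and by translation invariance each square
    integrates to the volume of the cube times int w^2; the two squares give the factor 2. *)
Lemma cubeI_quad r w : measurable_fun setT w -> (forall x, 0 <= w x) -> (0 <= r)%R ->
  \int[mu]_x (w x * cubeI r w x) <= (2 * (2 * r) ^+ n)%:E * \int[mu]_x (w x * w x).
Proof.
move=> mw w0 r0.
have mww : measurable_fun setT (fun x => w x * w x) by exact: emeasurable_funM.
have ww0 x : 0 <= w x * w x by exact: mule_ge0.
have v0 : (0 <= (2 * r) ^+ n)%R by rewrite exprn_ge0 // mulr_ge0.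
pose V := \int[mu]_x cubeI r (fun x => w x * w x) x.
have HV : V = ((2 * r) ^+ n)%:E * \int[mu]_x (w x * w x).
  rewrite /V /cubeI (fubini_tonelli (fun p : E * E => (\1_(cube r) p.2)%:E * (w (p.1 + p.2)%R * w (p.1 + p.2)%R))) /=; last 2 first.
  - exact: (mker r mww).
  - by move=> p; rewrite !mule_ge0.
  rewrite integral_cube_indM //; last exact: integral_ge0.
  apply: eq_integral => y _; rewrite ge0_integralZl //.
  - congr (_ * _); under eq_integral do rewrite addrC.
    exact: (ge0_integral_translate y mww ww0).
  - under eq_fun do rewrite addrC.
    by apply: (measurableT_comp mww); exact: measurable_addrVl.
(* The average of the constant 1 is the volume of the cube; written this way, both squares come from
   one integral in y. *)
apply: (@le_trans _ _ (\int[mu]_x (cubeI r (fun=> 1) x * (w x * w x) + cubeI r (fun x => w x * w x) x))).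
  apply: ge0_le_integral => //.
  - by move=> x _; apply: mule_ge0 => //; exact: cubeI_ge0.
  - by apply: emeasurable_funM => //; exact: measurable_cubeI.
  - apply: emeasurable_funD; last exact: measurable_cubeI.
    by apply: emeasurable_funM => //; exact: measurable_cubeI.
  move=> x _; rewrite /cubeI -ge0_integralZl //; last 2 first.
  - exact: mker1.
  - by move=> y _; apply: mule_ge0.
  rewrite -ge0_integralZr //; last first.
    by apply: (@mker1 r (fun=> 1) x); exact: measurable_cst.
  rewrite -ge0_integralD //; last 4 first.
  - by move=> y _; rewrite mule1 mule_ge0.
  - by under eq_fun do rewrite mule1; apply: emeasurable_funM.
  - by move=> y _; apply: mule_ge0.
  - exact: (@mker1 _ _ x mww).
  apply: ge0_le_integral => //.
  - by move=> y _; rewrite !mule_ge0.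
  - by apply: emeasurable_funM => //; exact: mker1.
  - apply: emeasurable_funD; last exact: (@mker1 _ _ x mww).
    by under eq_fun do rewrite mule1; apply: emeasurable_funM.
  move=> y _; rewrite mule1 muleCA -ge0_muleDr //; apply: lee_wpmul2l => //.
  by have := @mule_le_sqrD 1 (w x) (w (x + y)%R) ltr01 (w0 _) (w0 _); rewrite invr1 !mul1e.
rewrite ge0_integralD //; last 4 first.
- by move=> x _; apply: mule_ge0 => //; exact: cubeI_ge0.
- by apply: emeasurable_funM => //; exact: measurable_cubeI.
- by move=> x _; exact: cubeI_ge0.
- exact: measurable_cubeI.
rewrite -/V HV (eq_integral (fun x => ((2 * r) ^+ n)%:E * (w x * w x))); last first.
  move=> x _; congr (_ * _); rewrite -[RHS]mule1 integral_cube_indM //.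
rewrite ge0_integralZl_EFin // -ge0_muleDl ?lee_fin // -EFinD.
by rewrite (_ : _ + _ = 2 * (2 * r) ^+ n)%R //; ring.
Qed.

End cube_averages.

(** * The square function estimate *)

Section square_function.
Context {R : realType}.
Local Open Scope ring_scope.

(** The exponent [k.+1] keeps all scales strictly below 1, the range of the supremum in
    [local_maximal]; doubling the coarsest one gives exactly 1. *)
Definition scale (k : nat) : R := 2^-1 ^+ k.+1.

Lemma scale_gt0 k : 0 < scale k. Proof. by rewrite exprn_gt0. Qed.

Lemma scaleS k : scale k.+1 = scale k / 2.
Proof. by rewrite /scale exprSr. Qed.

Lemma scale_le1 k : scale k < 1.
Proof. by rewrite exprn_ilt1 // ?invr_ge0 // invf_lt1 // ltr1n. Qed.

Lemma sum_scale_min_le (h M q : R) m : 0 <= h -> 0 <= M -> 0 <= q ->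
  q ^+ 2 = h * M ->
  \sum_(k < m) scale k * Num.min h (M / scale k ^+ 2) <= 4 * q.
Proof.
move=> h0 M0 q0 qE.
have sq_le (x y : R) : 0 <= y -> x ^+ 2 <= y ^+ 2 -> x <= y.
  by move=> y0 xy; rewrite leNgt; apply/negP => yx; move: xy; rewrite !expr2; nra.
(* The sum is dominated by its last term until h <= M / t_m^2; from there on
   2 t_m h dominates the remaining terms. *)
have [H1 H2] : \sum_(k < m) scale k * Num.min h (M / scale k ^+ 2) <= M / scale m /\
    (h <= M / scale m ^+ 2 ->
     \sum_(k < m) scale k * Num.min h (M / scale k ^+ 2) + 2 * scale m * h <= 4 * q).
  elim: m => [|m [IH1 IH2]].
    rewrite big_ord0; split; first by rewrite divr_ge0 // ltW // scale_gt0.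
    rewrite /scale expr1 => hM; rewrite add0r mulfV // mul1r.
    have {}hM : h <= 4 * M.
      by rewrite (_ : 4 * M = M / (2^-1) ^+ 2) //; field.
    by apply: sq_le; [rewrite mulr_ge0|rewrite exprMn qE expr2; nra].
  rewrite big_ord_recr /= scaleS.
  set W := \sum_(k < m) _ in IH1 IH2 *.
  have t0 := scale_gt0 m; set t := scale m in IH1 IH2 t0 *.
  set x := M / t in IH1.
  have ME : M = x * t by rewrite /x mulfVK // gt_eqF.
  have x0 : 0 <= x by rewrite /x divr_ge0 // ltW.
  have -> : M / t ^+ 2 = x / t by rewrite ME; field; rewrite gt_eqF.
  have -> : M / (t / 2) = 2 * x by rewrite ME; field; rewrite gt_eqF.
  have -> : M / (t / 2) ^+ 2 = 4 * (x / t) by rewrite ME; field; rewrite gt_eqF.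
  have IH2' : h <= x / t -> W + 2 * t * h <= 4 * q.
    by move=> hx; apply: IH2; rewrite (_ : M / t ^+ 2 = x / t) // ME; field; rewrite gt_eqF.
  have tm1 : t * Num.min h (x / t) <= x.
    apply: (@le_trans _ _ (t * (x / t))); first by rewrite ler_pM2l // ge_min lexx orbT.
    by rewrite mulrCA mulfV ?gt_eqF // mulr1.
  split; first by lra.
  move=> hx; have {hx} hx : t * h <= 4 * x.
    rewrite (_ : 4 * x = t * (4 * (x / t))); first by rewrite ler_pM2l.
    by field; rewrite gt_eqF.
  rewrite (_ : 2 * (t / 2) * h = t * h); last by field.
  (* Here x = M / t, so q^2 = x (t h). In the crossing range x <= t h <= 4 x both x <= q and t h <=
     2 q hold, and the sum is at most x + x + t h <= 4 q: this fixes the constant 4. *)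
  have [hle|hlt] := leP h (x / t).
    have tm2 : t * Num.min h (x / t) <= t * h by rewrite ler_pM2l // ge_min lexx.
    by have := IH2' hle; lra.
  have {}hlt : x <= t * h by rewrite -ler_pdivrMl // mulrC ltW.
  have xq : x <= q by apply: sq_le => //; rewrite qE ME expr2; nra.
  have tq : t * h <= 2 * q.
    apply: sq_le; first by rewrite mulr_ge0.
    rewrite !exprMn qE ME !expr2.
    have : 0 <= t * h by rewrite mulr_ge0 // ltW.
    by nra.
  by rewrite (_ : t * (x / t) = x); [lra|field; rewrite gt_eqF].
have t0 := scale_gt0 m.
(* Past the crossing the surplus 2 t_m h is dropped; before it, (M / t_m)^2 = M (M / t_m^2) <= M h =
   q^2. *)
have [/H2 h2|hlt] := leP h (M / scale m ^+ 2).
  have : 0 <= 2 * scale m * h by rewrite !mulr_ge0 // ltW.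
  by lra.
apply: le_trans H1 _; apply: (@le_trans _ _ q); last by lra.
apply: sq_le => //; rewrite qE exprMn exprVn.
rewrite expr2 -mulrA [h * M]mulrC; apply: ler_wpM2l => //.
exact: ltW.
Qed.

Context {n : nat}.
Local Notation E := 'rV[R]_n.
Local Notation mu := (lebesgue_rV R n).
Local Open Scope ereal_scope.

(** Squaring removes sqrt(h M), so the bound makes sense for infinite [h]: then either M = 0 and
    every minimum vanishes, or the right-hand side is infinite. The constant 16 is 4^2. *)
Lemma sum_scale_mine_sqr_le (h : \bar R) (M : R) m : 0 <= h -> (0 <= M)%R ->
  let W := \sum_(k < m) (scale k)%:E * mine h (M / scale k ^+ 2)%:E in
  W * W <= (16 * M)%:E * h.
Proof.
move=> h0 M0 /=; set W := (\sum_(k < m) _)%R.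
case: h h0 @W => [h| |] //; last first.
  move=> _ W; move: M0; rewrite le_eqVlt => /predU1P[M0|M0].
    rewrite {}/W -M0 big1 ?mule0 ?mulr0 ?mul0e // => k _.
    by rewrite mul0r min_r ?leey // mule0.
  by rewrite mulry gtr0_sg ?mulr_gt0 // mul1e leey.
rewrite lee_fin => h0 W.
have -> : W = (\sum_(k < m) scale k * Num.min h (M / scale k ^+ 2))%R%:E.
  by rewrite /W -sumEFin; apply: eq_bigr => k _; rewrite -EFin_min -EFinM.
have q0 : (0 <= Num.sqrt (h * M))%R by exact: sqrtr_ge0.
have qE : (Num.sqrt (h * M) ^+ 2 = h * M)%R by rewrite sqr_sqrtr // mulr_ge0.
have := sum_scale_min_le m h0 M0 q0 qE.
set w := (\sum_(k < m) _)%R => hw.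
have w0 : (0 <= w)%R.
  apply: sumr_ge0 => k _; rewrite mulr_ge0 ?(ltW (scale_gt0 _)) // le_min h0 /=.
  by rewrite divr_ge0 // exprn_ge0 // ltW // scale_gt0.
rewrite -!EFinM lee_fin.
by move: qE; rewrite expr2; nra.
Qed.

(** Absorption of half of the left-hand side; finiteness of [x] is what permits the subtraction. *)
Lemma le_half_self (x y : \bar R) : 0 <= x -> x < +oo ->
  x <= 2^-1%:E * x + y -> x <= 2%:E * y.
Proof.
case: x => [x| |] // x0 _; case: y => [y| |] //; last first.
  by rewrite mulry gtr0_sg // mul1e leey.
by rewrite -!EFinM -EFinD !lee_fin => ?; lra.
Qed.

Variable m : nat.
Variable b : nat -> E -> \bar R.
Hypothesis mb : forall k, measurable_fun setT (b k).
Hypothesis b0 : forall k x, 0 <= b k x.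
(** The factor 4 is the growth of t^-2 when t is halved. It allows [b k.+1] on a doubled cube to be
    compared with [b k]. *)
Hypothesis bS : forall k x, b k.+1 x <= 4%:E * b k x.

(* The weight t_k of the average A_k = t_k^-n cubeI t_k. *)
Definition swt k : R := (scale k * (scale k)^-1 ^+ n)%R.

Definition Sfun x := \sum_(k < m) (swt k)%:E * cubeI (scale k) (b k) x.
Definition Wfun x := \sum_(k < m) (scale k)%:E * b k x.

Lemma swt_ge0 k : (0 <= swt k)%R.
Proof. by have := scale_gt0 k; move/ltW => h; rewrite mulr_ge0 // exprn_ge0 // invr_ge0. Qed.

Lemma swtS k : (swt k.+1 <= 2 ^+ n * swt k)%R.
Proof.
have t0 := scale_gt0 k.
have P0 : (0 <= 2 ^+ n * swt k)%R by rewrite mulr_ge0 ?swt_ge0 // exprn_ge0.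
rewrite {1}/swt scaleS invfM invrK exprMn.
rewrite (_ : scale k / 2 * ((scale k)^-1 ^+ n * 2 ^+ n) = (2 ^+ n * swt k) / 2)%R.
  by lra.
by rewrite /swt; field.
Qed.

Let t0 k : (0 <= scale k)%R. Proof. exact/ltW/scale_gt0. Qed.
Let B j x := (scale j)%:E * b j x.
Let X k x := (swt k)%:E * cubeI (scale k) (b k) x.
(** [X k] on the doubled cube, the form in which [cubeI_pair] returns a product of two averages. *)
Let H k x := (swt k)%:E * cubeI (2 * scale k) (b k) x.

Let B0 j x : 0 <= B j x. Proof. by rewrite mule_ge0 // lee_fin. Qed.
Let X0 k x : 0 <= X k x.
Proof. by rewrite mule_ge0 ?lee_fin ?swt_ge0 // cubeI_ge0. Qed.
Let H0 k x : 0 <= H k x.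
Proof. by rewrite mule_ge0 ?lee_fin ?swt_ge0 // cubeI_ge0. Qed.
Let mB k : measurable_fun setT (B k).
Proof. exact: emeasurable_funM. Qed.
Let mX k : measurable_fun setT (X k).
Proof. by apply: emeasurable_funM => //; exact: measurable_cubeI. Qed.
Let mH k : measurable_fun setT (H k).
Proof. by apply: emeasurable_funM => //; exact: measurable_cubeI. Qed.
Let Hs x := \sum_(k < m) H k x.
Let Hs0 x : 0 <= Hs x. Proof. exact: sume_ge0. Qed.
Let mHs : measurable_fun setT Hs. Proof. exact: emeasurable_sum. Qed.

Lemma Sfun_ge0 x : 0 <= Sfun x. Proof. by apply: sume_ge0 => k _; exact: X0. Qed.
Lemma Wfun_ge0 x : 0 <= Wfun x. Proof. by apply: sume_ge0 => k _; exact: B0. Qed.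
Lemma measurable_Sfun : measurable_fun setT Sfun.
Proof. by apply: emeasurable_sum => k; exact: mX. Qed.
Lemma measurable_Wfun : measurable_fun setT Wfun.
Proof. by apply: emeasurable_sum => k; exact: mB. Qed.
Let S0 := Sfun_ge0.
Let W0 := Wfun_ge0.
Let mS := measurable_Sfun.
Let mW := measurable_Wfun.

(** For j <= k the cube of index k is the smaller one. Its volume (2 t_k)^n, produced by
    [cubeI_pair], cancels the normalization t_k^-n inside [swt k] and leaves 2^n t_k. *)
Let pair_le j k : (j <= k)%N ->
  \int[mu]_x (X k x * X j x) <= (2 ^+ n)%:E * \int[mu]_x (B k x * H j x).
Proof.
move=> jk.
have kj : (scale k <= scale j)%R.
  by rewrite /scale ler_wiXn2l // ?invf_le1 // ?ler1n // invr_ge0.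
have tk := scale_gt0 k.
have mI i r : measurable_fun setT (cubeI r (b i)) by exact: measurable_cubeI.
have I0 i r x : 0 <= cubeI r (b i) x by exact: cubeI_ge0.
have sw : (0 <= swt k * swt j)%R by rewrite mulr_ge0 ?swt_ge0.
have -> : \int[mu]_x (X k x * X j x) = (swt k * swt j)%:E *
    \int[mu]_x (cubeI (scale k) (b k) x * cubeI (scale j) (b j) x).
  rewrite -ge0_integralZl_EFin //.
  - by apply: eq_integral => x _; rewrite EFinM /X muleACA.
  - by move=> x _; rewrite mule_ge0.
  - exact: emeasurable_funM.
have -> : \int[mu]_x (B k x * H j x) = (scale k * swt j)%:E *
    \int[mu]_x (b k x * cubeI (2 * scale j) (b j) x).
  rewrite -ge0_integralZl_EFin //.
  - by apply: eq_integral => x _; rewrite EFinM /B /H muleACA.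
  - by move=> x _; rewrite mule_ge0.
  - exact: emeasurable_funM.
  - by rewrite mulr_ge0 ?swt_ge0.
apply: (@le_trans _ _ ((swt k * swt j)%:E * (((2 * scale k) ^+ n)%:E *
  \int[mu]_x (b k x * cubeI (2 * scale j) (b j) x)))).
  apply: lee_wpmul2l; first by rewrite lee_fin.
  exact: cubeI_pair.
rewrite !muleA -!EFinM.
rewrite (_ : swt k * swt j * (2 * scale k) ^+ n = 2 ^+ n * (scale k * swt j))%R //.
set a := swt j; rewrite /swt exprMn exprVn; field; rewrite expf_neq0 // gt_eqF //.
Qed.

(** The square is expanded into a double sum. [pair_le] applies to every pair in one of the two
    orders, so [G j k + G k j] dominates in both cases; this symmetrization costs the factor 2. *)
Let SS_le : \int[mu]_x (Sfun x * Sfun x) <= (2 * 2 ^+ n)%:E * \int[mu]_x (Wfun x * Hs x).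
Proof.
have mXX j k : measurable_fun setT (fun x => X j x * X k x) by exact: emeasurable_funM.
have mBH j k : measurable_fun setT (fun x => B j x * H k x) by exact: emeasurable_funM.
have c0 : (0 <= 2 ^+ n :> R)%R by rewrite exprn_ge0.
have -> : \int[mu]_x (Sfun x * Sfun x) = \sum_(j < m) \sum_(k < m) \int[mu]_x (X j x * X k x).
  under eq_integral => x _.
    rewrite {1}/Sfun ge0_sume_distrl; last by move=> k _; exact: X0.
    under eq_bigr => j _.
      rewrite ge0_sume_distrr; last by move=> k _; exact: X0.
      over.
    over.
  rewrite ge0_integral_sum //.
  - apply: eq_bigr => j _; rewrite ge0_integral_sum //.
    + by move=> k; exact: mXX.
    + by move=> k x _; apply: mule_ge0; exact: X0.
  - by move=> j; apply: emeasurable_sum => k; exact: mXX.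
  - by move=> j x _; apply: sume_ge0 => k _; apply: mule_ge0; exact: X0.
have -> : \int[mu]_x (Wfun x * Hs x) = \sum_(j < m) \sum_(k < m) \int[mu]_x (B j x * H k x).
  under eq_integral => x _.
    rewrite {1}/Wfun ge0_sume_distrl; last by move=> k _; exact: B0.
    under eq_bigr => j _.
      rewrite ge0_sume_distrr; last by move=> k _; exact: H0.
      over.
    over.
  rewrite ge0_integral_sum //.
  - apply: eq_bigr => j _; rewrite ge0_integral_sum //.
    + by move=> k; exact: mBH.
    + by move=> k x _; apply: mule_ge0; [exact: B0|exact: H0].
  - by move=> j; apply: emeasurable_sum => k; exact: mBH.
  - by move=> j x _; apply: sume_ge0 => k _; apply: mule_ge0; [exact: B0|exact: H0].
set G := fun j k => \int[mu]_x (B j x * H k x).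
have G0 j k : 0 <= G j k by apply: integral_ge0 => x _; rewrite mule_ge0.
apply: (@le_trans _ _ (\sum_(j < m) \sum_(k < m) (2 ^+ n)%:E * (G j k + G k j))).
  apply: lee_sum => j _; apply: lee_sum => k _.
  rewrite ge0_muleDr //.
  have [jk|/ltnW kj] := leqP j k.
    under eq_integral do rewrite muleC.
    by apply: le_trans (pair_le jk) _; rewrite leeDr // mule_ge0.
  by apply: le_trans (pair_le kj) _; rewrite leeDl // mule_ge0.
have -> : \sum_(j < m) \sum_(k < m) (2 ^+ n)%:E * (G j k + G k j) =
  (2 ^+ n)%:E * (\sum_(j < m) \sum_(k < m) G j k + \sum_(j < m) \sum_(k < m) G k j).
  rewrite -big_split /= ge0_sume_distrr.
    apply: eq_bigr => j _; rewrite -big_split /= ge0_sume_distrr // => k _.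
    by rewrite adde_ge0.
  by move=> j _; rewrite adde_ge0 // sume_ge0.
rewrite [X in _ * (_ + X)]exchange_big /= EFinM -muleA muleCA.
apply: lee_wpmul2l => //.
rewrite (_ : 2%:E = 1 + 1 :> \bar R); last by rewrite -EFinD.
by rewrite ge0_muleDl // mul1e.
Qed.


(** The doubled cube of index k+1 is the cube of index k, so shifting the index costs 2^n for the
    weight and 4 for [bS]. Only index 0 is left over: it lives on the unit cube, where b_0 = 2 (t_0
    b_0) is at most twice the sum of the [B k]. *)
Let sum_H_le m' x : \sum_(k < m') H k x <=
  (8 * 2 ^+ n)%:E * (\sum_(k < m') X k x + cubeI 1 (fun x => \sum_(k < m') B k x) x).
Proof.
have c0 : (0 <= 2 ^+ n :> R)%R by rewrite exprn_ge0.
have sum0 (F : nat -> E -> \bar R) p y : (forall k y, 0 <= F k y) -> 0 <= \sum_(k < p) F k y.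
  by move=> F0; apply: sume_ge0.
case: m' => [|p].
  by rewrite !big_ord0 mule_ge0 ?lee_fin ?mulr_ge0 // add0e cubeI_ge0 // => y; exact: sum0.
have I0 : 0 <= cubeI 1 (fun x => \sum_(k < p.+1) B k x) x.
  by apply: cubeI_ge0 => y; exact: sum0.
rewrite ge0_muleDr //; last exact: sum0.
rewrite big_ord_recl addeC; apply: leeD.
  apply: (@le_trans _ _ ((8 * 2 ^+ n)%:E * \sum_(k < p) X k x)); last first.
    apply: lee_wpmul2l; first by rewrite lee_fin mulr_ge0.
    by rewrite big_ord_recr /= leeDl.
  rewrite ge0_sume_distrr //; apply: lee_sum => k _.
  rewrite /H /X lift0 muleA -EFinM.
  apply: (@le_trans _ _ ((2 ^+ n * swt k)%:E * (4%:E * cubeI (scale k) (b k) x))).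
    apply: lee_pmul.
    - by rewrite lee_fin swt_ge0.
    - exact: cubeI_ge0.
    - by rewrite lee_fin swtS.
    rewrite -cubeIZ //; apply: le_cubeI => //.
    - exact: emeasurable_funM.
    - by rewrite scaleS mulrC divfK.
  rewrite muleA -EFinM; apply: lee_wpmul2r; first exact: cubeI_ge0.
  rewrite lee_fin -[X in (_ <= X)%R]mulrA [(8 * _)%R]mulrC.
  by apply: ler_wpM2l; [rewrite mulr_ge0 ?swt_ge0|lra].
rewrite /H /=.
have -> : (2 * scale 0 = 1)%R by rewrite /scale expr1 divff.
have -> : swt 0 = (2^-1 * 2 ^+ n)%R by rewrite /swt /scale expr1 invrK.
apply: (@le_trans _ _ ((2^-1 * 2 ^+ n)%:E * (2%:E * cubeI 1 (fun x => \sum_(k < p.+1) B k x) x))).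
  apply: lee_wpmul2l; first by rewrite lee_fin mulr_ge0.
  rewrite -cubeIZ //; [|by apply: emeasurable_sum|by move=> y; exact: sum0].
  apply: le_cubeI => //.
    by apply: emeasurable_funM => //; apply: emeasurable_sum.
  move=> y; rewrite big_ord_recl /= {1}/B /scale expr1 ge0_muleDr //; last exact: sume_ge0.
  - by rewrite muleA -EFinM divff // mul1e leeDl // mule_ge0 ?lee_fin // sume_ge0.
  - by rewrite mule_ge0 // lee_fin.
rewrite muleA -EFinM; apply: lee_wpmul2r => //.
by rewrite lee_fin; move: c0; lra.
Qed.

Let Sfun_fin : \int[mu]_x (Wfun x * Wfun x) < +oo -> \int[mu]_x (Sfun x * Sfun x) < +oo.
Proof.
move=> Woo.
(* From b_k <= t_k^-1 [Wfun] on the unit cube. This constant depends on the number [m] of scales,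
   which is harmless since only finiteness is wanted. *)
pose c : R := (\sum_(k < m) swt k * (scale k)^-1)%R.
have c0 : (0 <= c)%R.
  by apply: sumr_ge0 => k _; rewrite mulr_ge0 ?swt_ge0 // invr_ge0.
have mI : measurable_fun setT (cubeI 1 Wfun) by exact: measurable_cubeI.
have I0 x : 0 <= cubeI 1 Wfun x by exact: cubeI_ge0.
have Sle x : Sfun x <= c%:E * cubeI 1 Wfun x.
  rewrite /c -sumEFin ge0_sume_distrl => [|k _]; last first.
    by rewrite lee_fin mulr_ge0 ?swt_ge0 // invr_ge0.
  apply: lee_sum => k _; rewrite [X in _ <= X * _]EFinM -muleA; apply: lee_wpmul2l.
    by rewrite lee_fin swt_ge0.
  rewrite -cubeIZ ?invr_ge0 //; apply: le_cubeI => //.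
  - exact: emeasurable_funM.
  - move=> y; rewrite /Wfun (bigD1 k) //= ge0_muleDr //.
    + rewrite muleA -EFinM mulVf ?gt_eqF ?scale_gt0 // mul1e leeDl //.
      rewrite mule_ge0 ?lee_fin ?invr_ge0 //; apply: sume_ge0 => i _; exact: B0.
    + exact: B0.
    + by apply: sume_ge0 => i _; exact: B0.
  - exact/ltW/scale_le1.
apply: (@le_lt_trans _ _ (\int[mu]_x ((c * c)%:E * (cubeI 1 Wfun x * cubeI 1 Wfun x)))).
  apply: ge0_le_integral => //.
  - by move=> x _; rewrite mule_ge0.
  - exact: emeasurable_funM.
  - by apply: emeasurable_funM => //; exact: emeasurable_funM.
  by move=> x _; rewrite EFinM muleACA; apply: lee_pmul.
rewrite ge0_integralZl_EFin //; last 3 first.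
- by move=> x _; rewrite mule_ge0.
- exact: emeasurable_funM.
- by rewrite mulr_ge0.
apply: (@le_lt_trans _ _ ((c * c)%:E * (((2 * 1) ^+ n)%:E * ((2 * (2 * (2 * 1)) ^+ n)%:E *
    \int[mu]_x (Wfun x * Wfun x))))).
  apply: lee_wpmul2l; first by rewrite lee_fin mulr_ge0.
  apply: (le_trans (cubeI_pair mW W0 mW W0 ler01 (lexx 1%R))).
  apply: lee_wpmul2l; first by rewrite lee_fin exprn_ge0 // mulr_ge0.
  by apply: cubeI_quad => //; rewrite mulr_ge0.
have : 0 <= \int[mu]_x (Wfun x * Wfun x) by apply: integral_ge0 => x _; rewrite mule_ge0.
by move: Woo; case: (\int[mu]_x _) => // r _ _; rewrite -!EFinM ltry.
Qed.

(** With d = 2^n, [SS_le] and [sum_H_le] give the factor K = (2 d)(8 d) = 16 d^2. Young's inequality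
    with l = 1/(2 K) turns K S W into S^2 / 2 + 2 K^2 W^2, the average over the unit cube adds K (2
    d) = 32 d^3 by [cubeI_quad], and absorbing S^2 / 2 doubles the sum. *)
Theorem square_function_le : \int[mu]_x (Wfun x * Wfun x) < +oo ->
  \int[mu]_x (Sfun x * Sfun x) <=
  (2 * (2 * (16 * (2 ^+ n) ^+ 2) ^+ 2 + 32 * (2 ^+ n) ^+ 3))%:E *
    \int[mu]_x (Wfun x * Wfun x).
Proof.
move=> Woo; have Soo := Sfun_fin Woo.
set d : R := (2 ^+ n)%R; have d0 : (0 < d)%R by rewrite exprn_gt0.
pose K : R := (16 * d ^+ 2)%R.
have K0 : (0 < K)%R by rewrite mulr_gt0 // exprn_gt0.
have mI : measurable_fun setT (cubeI 1 Wfun) by exact: measurable_cubeI.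
have I0 x : 0 <= cubeI 1 Wfun x by exact: cubeI_ge0.
have SS0 : 0 <= \int[mu]_x (Sfun x * Sfun x) by apply: integral_ge0 => x _; rewrite mule_ge0.
have WW0 : 0 <= \int[mu]_x (Wfun x * Wfun x) by apply: integral_ge0 => x _; rewrite mule_ge0.
have mSS : measurable_fun setT (fun x => Sfun x * Sfun x) by exact: emeasurable_funM.
have mWW : measurable_fun setT (fun x => Wfun x * Wfun x) by exact: emeasurable_funM.
have mWI : measurable_fun setT (fun x => Wfun x * cubeI 1 Wfun x) by exact: emeasurable_funM.
have m1 : measurable_fun setT (fun x => 2^-1%:E * (Sfun x * Sfun x)) by exact: emeasurable_funM.
have m2 : measurable_fun setT (fun x => (2 * K ^+ 2)%:E * (Wfun x * Wfun x)) by exact: emeasurable_funM.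
have m3 : measurable_fun setT (fun x => K%:E * (Wfun x * cubeI 1 Wfun x)) by exact: emeasurable_funM.
rewrite EFinM -muleA; apply: le_half_self => //.
apply: (le_trans SS_le).
apply: (@le_trans _ _ (\int[mu]_x (2^-1%:E * (Sfun x * Sfun x) +
   ((2 * K ^+ 2)%:E * (Wfun x * Wfun x) + K%:E * (Wfun x * cubeI 1 Wfun x))))).
  have mWH : measurable_fun setT (fun x => Wfun x * Hs x) by exact: emeasurable_funM.
  have WH0 x : setT x -> 0 <= Wfun x * Hs x by rewrite mule_ge0.
  have d20 : (0 <= 2 * d)%R by rewrite mulr_ge0 // ltW.
  rewrite -(ge0_integralZl_EFin mu measurableT WH0 mWH d20).
  apply: ge0_le_integral; first exact: measurableT.
  - by move=> x _; rewrite !mule_ge0 // lee_fin mulr_ge0 // ltW.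
  - exact: emeasurable_funM.
  - exact: (emeasurable_funD m1 (emeasurable_funD m2 m3)).
  move=> x _.
  apply: (@le_trans _ _ (K%:E * (Wfun x * (Sfun x + cubeI 1 Wfun x)))).
    rewrite (_ : K = (2 * d) * (8 * d))%R; last by rewrite /K; ring.
    rewrite [X in _ <= X * _]EFinM -muleA; apply: lee_wpmul2l; first by rewrite lee_fin.
    by rewrite muleCA; apply: lee_wpmul2l => //; exact: sum_H_le.
  rewrite [Wfun x * (_ + _)]ge0_muleDr // ge0_muleDr ?mule_ge0 // addeA; apply: leeD => //.
  have k0 : (0 < (2 * K)^-1)%R by rewrite invr_gt0 mulr_gt0.
  have := mule_le_sqrD k0 (S0 x) (W0 x); rewrite invrK muleC => h.
  apply: le_trans (lee_wpmul2l _ h) _; first by rewrite lee_fin ltW.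
  rewrite ge0_muleDr ?mule_ge0 ?lee_fin ?(ltW k0) ?mulr_ge0 ?(ltW K0) ?(ltW d0) //.
  rewrite !muleA -!EFinM -!muleA.
  rewrite (_ : K * (2 * K)^-1 = 2^-1)%R; last by field; rewrite gt_eqF.
  rewrite (_ : K * (2 * K) = 2 * K ^+ 2)%R; last by ring.
  by [].
have S1 x : setT x -> 0 <= Sfun x * Sfun x by rewrite mule_ge0.
have W1 x : setT x -> 0 <= Wfun x * Wfun x by rewrite mule_ge0.
have I1 x : setT x -> 0 <= Wfun x * cubeI 1 Wfun x by rewrite mule_ge0.
have h0 : (0 <= 2^-1 :> R)%R by [].
have K20 : (0 <= 2 * K ^+ 2)%R by rewrite mulr_ge0 // exprn_ge0 // ltW.
rewrite (ge0_integralD mu measurableT (f1 := fun x => 2^-1%:E * (Sfun x * Sfun x))) //; last 3 first.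
- by move=> x _; rewrite !mule_ge0.
- by move=> x _; rewrite adde_ge0 // mule_ge0 ?lee_fin ?W1 ?I1 // ltW.
- exact: (emeasurable_funD m2 m3).
rewrite (ge0_integralZl_EFin mu measurableT S1 mSS h0).
apply: leeD; first exact: lexx.
rewrite (ge0_integralD mu measurableT _ m2 _ m3); last 2 first.
- by move=> x _; rewrite mule_ge0 ?lee_fin ?W1.
- by move=> x _; rewrite mule_ge0 ?lee_fin ?I1 // ltW.
rewrite (ge0_integralZl_EFin mu measurableT W1 mWW K20).
rewrite (ge0_integralZl_EFin mu measurableT I1 mWI (ltW K0)).
rewrite EFinD ge0_muleDl; last 2 first.
- by rewrite lee_fin mulr_ge0 // exprn_ge0 // ltW.
- by rewrite lee_fin mulr_ge0 // exprn_ge0 // ltW.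
apply: leeD; first exact: lexx.
apply: le_trans (lee_wpmul2l _ (cubeI_quad mW W0 ler01)) _.
  by rewrite lee_fin ltW.
rewrite muleA -EFinM mulr1 -/d (_ : K * (2 * d) = 32 * d ^+ 3)%R //.
by rewrite /K; ring.
Qed.

End square_function.

(** * Mollification *)

Section mollification.
Context {R : realType} {n : nat}.
Local Notation E := 'rV[R]_n.
Local Notation mu := (lebesgue_rV R n).
Local Open Scope ereal_scope.

Lemma dmap_const (t : R) (x y : E) : dmap (const_mx t) x y = (x + t *: y)%R.
Proof. by apply/rowP => i; rewrite !mxE addrC. Qed.

Lemma ge0_integral_dilate (t : R) (x : E) (F : E -> \bar R) : (0 < t)%R ->
  measurable_fun setT F -> (forall z, 0 <= F z) ->
  \int[mu]_y F (x + t *: y)%R = (t ^- n)%:E * \int[mu]_z F z.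
Proof.
move=> t0 mF F0.
have := @ge0_integral_dmap _ n (const_mx t) x F _ mF F0.
under eq_integral do rewrite dmap_const.
move=> ->; last by move=> i; rewrite mxE gt_eqF.
congr (_%:E * _); rewrite (eq_bigr (fun=> t^-1)%R) => [|i _].
  by rewrite prodr_const card_ord exprVn.
by rewrite mxE gtr0_norm.
Qed.

Lemma integral_dilate (t : R) (x : E) (F : E -> \bar R) : (0 < t)%R ->
  mu.-integrable setT F ->
  \int[mu]_y F (x + t *: y)%R = (t ^- n)%:E * \int[mu]_z F z.
Proof.
move=> t0 iF; have mF := measurable_int mu iF.
rewrite [in RHS]integralE muleBr //; last first.
  by rewrite fin_num_adde_defr // integrable_pos_fin_num.
rewrite -!(ge0_integral_dilate x t0) //; last 2 first.
- exact: measurable_funeneg.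
- exact: measurable_funepos.
rewrite [LHS]integralE; congr (_ - _); apply: eq_integral => y _.
  by rewrite !funeposE.
by rewrite !funenegE.
Qed.

Lemma measurable_dilate2 (t : R) :
  measurable_fun setT (fun p : E * E => p.1 + t *: p.2)%R.
Proof.
apply: measurable_fun_rVP => i.
rewrite (_ : _ \o _ = fun p : E * E => (rV_coord i p.1 + t * rV_coord i p.2)%R).
  apply: measurable_funD; first exact: (measurableT_comp (measurable_rV_coord i)).
  by apply: measurable_funM => //; apply: (measurableT_comp (measurable_rV_coord i)).
by apply/funext => x; rewrite /= /rV_coord !mxE.
Qed.

Lemma measurable_dilate1 (t : R) (x : E) : measurable_fun setT (fun y : E => x + t *: y)%R.
Proof.
have h : measurable_fun setT (fun y : E => (x, y)) by exact: measurable_fun_pair.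
exact: (measurableT_comp (measurable_dilate2 t) h).
Qed.

Lemma integrable_cube (r : R) : (0 <= r)%R ->
  mu.-integrable setT (fun y : E => (\1_(cube r) y)%:E).
Proof.
move=> r0; apply/integrableP; split.
  by apply/measurable_EFinP; apply: measurable_indic; exact: measurable_cube.
under eq_integral do rewrite gee0_abs ?lee_fin //.
by rewrite integral_cube_ind // ltry.
Qed.

Lemma integral_cube1M (y : \bar R) : 0 <= y ->
  (2 ^+ n)%:E * y = \int[mu]_z ((\1_(cube 1) z)%:E * y).
Proof. by move=> y0; rewrite -integral_cube_indM // mulr1. Qed.

(** A class stable under mollification and subtraction, on which the integrals against [phi]
    converge. *)
Definition bdd_meas (F : E -> R) :=
  measurable_fun setT F /\ exists B : R, forall x, (`|F x| <= B)%R.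

Variables (phi : E -> R) (cphi : R).
Hypothesis mphi : measurable_fun setT phi.
Hypothesis phib : forall y, (`|phi y| <= cphi * \1_(cube 1) y)%R.

Lemma cphi_ge0 : (0 <= cphi)%R.
Proof.
have := phib 0; rewrite indicE mem_set ?mulr1; last by move=> i; rewrite mxE normr0.
exact: le_trans.
Qed.

Lemma integrable_phiM G : bdd_meas G -> mu.-integrable setT (fun y => (phi y * G y)%:E).
Proof.
move=> [mG [B GB]].
apply: (@le_integrable _ _ _ _ _ measurableT _ (fun y => (cphi * B)%:E * (\1_(cube 1) y)%:E)).
- by apply/measurable_EFinP; exact: measurable_funM.
- move=> y _ /=; rewrite lee_fin normrM [leRHS]ger0_norm; last first.
    by rewrite !mulr_ge0 ?cphi_ge0 // (le_trans _ (GB y)).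
  by rewrite mulrAC ler_pM.
- by apply: integrableZl => //; exact: integrable_cube.
Qed.

Lemma phiM_abs_le G : bdd_meas G ->
  `|\int[mu]_y (phi y * G y)|%R%:E <= cphi%:E * \int[mu]_y ((\1_(cube 1) y)%:E * `|G y|%:E).
Proof.
move=> bG; have [mG _] := bG.
have mi : measurable_fun setT (fun y : E => (\1_(cube 1) y)%:E : \bar R).
  by apply/measurable_EFinP; apply: measurable_indic; exact: measurable_cube.
have mG' : measurable_fun setT (fun y => `|G y|%:E).
  by apply/measurable_EFinP; exact: measurableT_comp.
rewrite EFin_normr_Rintegral //; last exact: integrable_phiM.
apply: le_trans (le_abse_integral _ _ _) _ => //.
  by apply/measurable_EFinP; exact: measurable_funM.
rewrite -ge0_integralZl_EFin ?cphi_ge0 //; last exact: emeasurable_funM.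
apply: ge0_le_integral => //.
- by apply/measurable_EFinP; apply: measurableT_comp => //; exact: measurable_funM.
- by apply: emeasurable_funM => //; exact: emeasurable_funM.
by move=> y _; rewrite abse_EFin normrM muleA EFinM lee_wpmul2r // -EFinM lee_fin.
Qed.

Lemma phiM_le G (e : R) : (0 <= e)%R -> bdd_meas G -> (forall y, cube 1 y -> `|G y| <= e)%R ->
  (`|\int[mu]_y (phi y * G y)| <= cphi * 2 ^+ n * e)%R.
Proof.
move=> e0 bG Ge; have [mG _] := bG.
rewrite -lee_fin; apply: (le_trans (phiM_abs_le bG)).
rewrite -mulrA EFinM; apply: lee_wpmul2l; first by rewrite lee_fin cphi_ge0.
rewrite EFinM integral_cube1M //.
have mi : measurable_fun setT (fun y : E => (\1_(cube 1) y)%:E : \bar R).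
  by apply/measurable_EFinP; apply: measurable_indic; exact: measurable_cube.
apply: ge0_le_integral => //.
- apply: emeasurable_funM => //.
  by apply/measurable_EFinP; exact: measurableT_comp.
- exact: emeasurable_funM.
move=> y _; rewrite indicE; case: (boolP (y \in _)) => [/set_mem h|_]; last by rewrite !mul0e.
by rewrite !mul1e lee_fin Ge.
Qed.

(** The kernel is the reflected one, which makes this the adjoint of convolution with
    [dilate phi t]. The scale sits in the argument of [F], so [phi] and its support stay fixed. *)
Definition mollify (t : R) (F : E -> R) (x : E) : R :=
  (\int[mu]_y (phi y * F (x + t *: y)))%R.

Lemma bdd_meas_dilate t F x : bdd_meas F -> bdd_meas (fun y => F (x + t *: y)%R).
Proof.
move=> [mF [B FB]]; split; last by exists B.
exact: (measurableT_comp mF (measurable_dilate1 t x)).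
Qed.

Lemma mollify_le t F B x : bdd_meas F -> (forall x, `|F x| <= B)%R ->
  (`|mollify t F x| <= cphi * 2 ^+ n * B)%R.
Proof.
move=> bF FB; apply: phiM_le => //; first exact: le_trans (normr_ge0 _) (FB 0%R).
exact: bdd_meas_dilate.
Qed.

Lemma bdd_meas_mollify t F : bdd_meas F -> bdd_meas (mollify t F).
Proof.
move=> bF; have [mF [B FB]] := bF; split; last first.
  by exists (cphi * 2 ^+ n * B)%R => x; exact: mollify_le.
pose H (p : E * E) : \bar R := (phi p.2 * F (p.1 + t *: p.2))%:E.
have mH : measurable_fun setT H.
  apply/measurable_EFinP; apply: measurable_funM.
    exact: (measurableT_comp mphi).
  exact: (measurableT_comp mF (measurable_dilate2 t)).
(* The integral of a signed kernel is the difference of two Tonelli integrals, each measurable in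
   the parameter. *)
rewrite (_ : mollify t F = fine \o (fun x => \int[mu]_y (H^\+ (x, y)) - \int[mu]_y (H^\- (x, y)))).
  apply: measurableT_comp => //; apply: emeasurable_funB.
    apply: (@measurable_fun_fubini_tonelli_F _ _ _ _ _ mu) => //.
    exact: measurable_funepos.
  apply: (@measurable_fun_fubini_tonelli_F _ _ _ _ _ mu) => //.
  exact: measurable_funeneg.
apply/funext => x; rewrite /mollify /Rintegral /= integralE; congr fine.
by congr (_ - _); apply: eq_integral => y _; rewrite ?funeposE ?funenegE.
Qed.

Lemma mollifyB t F G x : bdd_meas F -> bdd_meas G ->
  mollify t (fun x => F x - G x)%R x = (mollify t F x - mollify t G x)%R.
Proof.
move=> bF bG; rewrite /mollify -RintegralB //; last 2 first.
- exact: (integrable_phiM (bdd_meas_dilate t x bF)).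
- exact: (integrable_phiM (bdd_meas_dilate t x bG)).
by apply: eq_Rintegral => y _; rewrite mulrBr.
Qed.

Lemma bdd_measB F G : bdd_meas F -> bdd_meas G -> bdd_meas (fun x => F x - G x)%R.
Proof.
move=> [mF [B FB]] [mG [B' GB]]; split; first exact: measurable_funB.
by exists (B + B')%R => x; rewrite (le_trans (ler_normB _ _)) // lerD.
Qed.

Lemma EFin_mollify t F x : bdd_meas F ->
  (mollify t F x)%:E = \int[mu]_y (phi y * F (x + t *: y)%R)%:E.
Proof.
move=> bF; rewrite /mollify /Rintegral fineK //.
by apply: integrable_fin_num => //; exact: (integrable_phiM (bdd_meas_dilate t x bF)).
Qed.

(** Fubini: the integrand depends on the two variables through x + s y + t z and is dominated by a
    constant on the product of two unit cubes. *)
Lemma mollifyC s t F x : bdd_meas F ->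
  mollify s (mollify t F) x = mollify t (mollify s F) x.
Proof.
move=> bF; have [mF [B FB]] := bF.
have B0 : (0 <= B)%R by exact: le_trans (normr_ge0 _) (FB 0%R).
apply: EFin_inj.
transitivity (\int[mu]_y (phi y * mollify t F (x + s *: y)%R)%:E).
  exact: (EFin_mollify s x (bdd_meas_mollify t bF)).
transitivity (\int[mu]_y (phi y * mollify s F (x + t *: y)%R)%:E); last first.
  exact/esym/(EFin_mollify t x (bdd_meas_mollify s bF)).
pose H (p : E * E) : \bar R := (phi p.1 * (phi p.2 * F (x + s *: p.1 + t *: p.2)))%:E.
have mH : measurable_fun setT H.
  apply/measurable_EFinP; apply: measurable_funM.
    exact: (measurableT_comp mphi).
  apply: measurable_funM; first exact: (measurableT_comp mphi).
  have h : measurable_fun setT (fun p : E * E => (x + s *: p.1, p.2)%R).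
    apply: measurable_fun_pair => //.
    exact: (measurableT_comp (measurable_dilate1 s x)).
  exact: (measurableT_comp mF (measurableT_comp (measurable_dilate2 t) h)).
have mi : measurable_fun setT (fun y : E => (\1_(cube 1) y)%:E : \bar R).
  by apply/measurable_EFinP; apply: measurable_indic; exact: measurable_cube.
have iH : (mu \x mu).-integrable setT H.
  apply/integrable12ltyP => //.
  pose c : R := (cphi * cphi * B)%R.
  have c0 : (0 <= c)%R by rewrite !mulr_ge0 ?cphi_ge0.
  apply: (@le_lt_trans _ _ (\int[mu]_y \int[mu]_z (c%:E * (\1_(cube 1) y)%:E * (\1_(cube 1) z)%:E))); last first.
    under eq_integral => y _.
      rewrite ge0_integralZl //; last by rewrite mule_ge0 ?lee_fin.
      over.
    rewrite ge0_integralZr //; last 3 first.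
    - exact: emeasurable_funM.
    - by move=> y _; rewrite mule_ge0 ?lee_fin.
    - by apply: integral_ge0 => y _; rewrite lee_fin.
    by rewrite ge0_integralZl // integral_cube_ind // -!EFinM ltry.
  have mK : measurable_fun setT (fun p : E * E => c%:E * (\1_(cube 1) p.1)%:E * (\1_(cube 1) p.2)%:E).
    apply: emeasurable_funM; last exact: (measurableT_comp mi).
    by apply: emeasurable_funM => //; exact: (measurableT_comp mi).
  have K0 (p : E * E) : 0 <= c%:E * (\1_(cube 1) p.1)%:E * (\1_(cube 1) p.2)%:E.
    by rewrite !mule_ge0 ?lee_fin.
  have mHa : measurable_fun setT (fun p => `|H p|) by exact: measurableT_comp.
  apply: ge0_le_integral => //.
  - by move=> y _; apply: integral_ge0.
  - exact: (@measurable_fun_fubini_tonelli_F _ _ _ _ _ mu _ mHa).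
  - exact: (@measurable_fun_fubini_tonelli_F _ _ _ _ _ mu _ mK).
  move=> y _; apply: ge0_le_integral => //.
  - exact: (measurable_fun_pair2 y mHa).
  - exact: (measurable_fun_pair2 y mK).
  move=> z _; rewrite /H /= lee_fin !normrM /c.
  have -> : (cphi * cphi * B * \1_(cube 1) y * \1_(cube 1) z =
    (cphi * \1_(cube 1) y) * ((cphi * \1_(cube 1) z) * B))%R by ring.
  by rewrite !ler_pM // mulr_ge0.
transitivity (\int[mu]_y \int[mu]_z H (y, z)).
  apply: eq_integral => y _; rewrite EFinM EFin_mollify // -integralZl //.
  exact: (integrable_phiM (bdd_meas_dilate t _ bF)).
rewrite (Fubini iH); apply: eq_integral => z _.
rewrite EFinM EFin_mollify // -integralZl //; last first.
  exact: (integrable_phiM (bdd_meas_dilate s _ bF)).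
by apply: eq_integral => y _; rewrite /H /= mulrCA addrAC.
Qed.

(** The left-hand side integrates [phi] against F - a. The value [a] is arbitrary because the lemma
    is used at two levels: near f(x), and near (int phi) f(x) after one mollification. *)
Lemma mollify_near t F x a e : (0 <= e)%R -> bdd_meas F ->
  (forall y, cube 1 y -> `|F (x + t *: y) - a| <= e)%R ->
  (`|mollify t F x - (\int[mu]_y phi y)%R * a| <= cphi * 2 ^+ n * e)%R.
Proof.
move=> e0 bF Fa.
have b1 : bdd_meas (fun=> a) by split; [exact: measurable_cst|exists `|a|%R].
have ia := integrable_phiM b1.
have ip : mu.-integrable setT (EFin \o phi).
  apply: eq_integrable (integrable_phiM (G := fun=> 1%R) _) => //.
    by move=> y _; rewrite mulr1.
  by split; [exact: measurable_cst|exists 1%R; rewrite normr1].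
rewrite -RintegralZr // -RintegralB //; last first.
  exact: (integrable_phiM (bdd_meas_dilate t x bF)).
under eq_Rintegral do rewrite -mulrBr.
apply: phiM_le => //; apply: bdd_measB => //.
exact: bdd_meas_dilate.
Qed.

(** Fubini for F(x) phi_t(x - z) g(z); in the integral over x the substitution x = z + t y turns
    phi_t(x - z) into t^-n phi(y). *)
Lemma mollify_adjoint t F g : (0 < t)%R -> bdd_meas F -> mu.-integrable setT (EFin \o g) ->
  \int[mu]_x (mollify t F x * g x)%:E =
  \int[mu]_x ((F x)%:E * convolution (dilate phi t) g x).
Proof.
move=> t0 bF ig; have [mF [B FB]] := bF.
have B0 : (0 <= B)%R by exact: le_trans (normr_ge0 _) (FB 0%R).
have tn0 : (0 < t ^+ n)%R by rewrite exprn_gt0.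
have ti0 : (0 <= t ^- n)%R by rewrite invr_ge0 ltW.
have mg : measurable_fun setT g by apply/measurable_EFinP; exact: measurable_int ig.
have mdil : measurable_fun setT (dilate phi t).
  apply: measurable_funM => //; apply: (measurableT_comp mphi).
  have := measurable_dilate1 t^-1 0; by under eq_fun do rewrite add0r.
have dilE (z y : E) : dilate phi t (z + t *: y - z)%R = (t ^- n * phi y)%R.
  by rewrite /dilate addrC addKr scalerA mulVf ?gt_eqF // scale1r.
have mi : measurable_fun setT (fun y : E => (\1_(cube 1) y)%:E : \bar R).
  by apply/measurable_EFinP; apply: measurable_indic; exact: measurable_cube.
pose H (p : E * E) : \bar R := (F p.1 * (dilate phi t (p.1 - p.2)%R * g p.2))%:E.
have mH : measurable_fun setT H.
  apply/measurable_EFinP; apply: measurable_funM; first exact: (measurableT_comp mF).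
  apply: measurable_funM; last exact: (measurableT_comp mg).
  have h := @measurable_dilate2 (-1)%R.
  have {}h : measurable_fun setT (fun p : E * E => (p.1 - p.2)%R).
    by under eq_fun do rewrite -scaleN1r.
  exact: (measurableT_comp mdil h).
have mHa : measurable_fun setT (fun p => `|H p|) by exact: measurableT_comp.
(* The powers of t cancel after the substitution; integrating this bound in z yields the
   integrability that Fubini requires. *)
have inner z : \int[mu]_x `|H (x, z)| <= (cphi * B * 2 ^+ n)%:E * `|(g z)%:E|.
  have -> : \int[mu]_x `|H (x, z)| = (t ^+ n)%:E * \int[mu]_y `|H (z + t *: y, z)%R|.
    rewrite (@ge0_integral_dilate t z (fun x => `|H (x, z)|)) //.
      by rewrite muleA -EFinM divff ?gt_eqF // mul1e.
    exact: (measurable_fun_pair1 z mHa).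
  rewrite -ge0_integralZl_EFin ?(ltW tn0) //; last first.
    exact: (measurableT_comp (measurable_fun_pair1 z mHa) (measurable_dilate1 t z)).
  rewrite [X in _ <= X * _]EFinM -muleA integral_cube1M // -ge0_integralZl_EFin //; last 2 first.
  - exact: emeasurable_funM.
  - by rewrite mulr_ge0 ?cphi_ge0.
  apply: ge0_le_integral => //.
  - by move=> y _; rewrite mule_ge0 // lee_fin // ltW.
  - apply: emeasurable_funM => //.
    exact: (measurableT_comp (measurable_fun_pair1 z mHa) (measurable_dilate1 t z)).
  - by apply: emeasurable_funM => //; apply: emeasurable_funM.
  move=> y _; rewrite /H /= dilE -!EFinM lee_fin !normrM (ger0_norm ti0).
  have -> : (t ^+ n * (`|F (z + t *: y)| * (t ^- n * `|phi y| * `|g z|)) =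
     `|phi y| * (`|F (z + t *: y)| * `|g z|))%R by field; rewrite gt_eqF.
  have -> : (cphi * B * (\1_(cube 1) y * `|g z|) = (cphi * \1_(cube 1) y) * (B * `|g z|))%R by ring.
  by rewrite !ler_pM // mulr_ge0.
have iH : (mu \x mu).-integrable setT H.
  apply/integrable21ltyP => //.
  have [_ goo] := integrableP _ _ _ ig.
  apply: (@le_lt_trans _ _ (\int[mu]_z ((cphi * B * 2 ^+ n)%:E * `|(g z)%:E|))).
    apply: ge0_le_integral => //.
    - by move=> z _; exact: integral_ge0.
    - exact: (@measurable_fun_fubini_tonelli_G _ _ _ _ _ mu _ mHa).
    - apply: emeasurable_funM => //; apply: measurableT_comp => //.
      exact/measurable_EFinP.
  rewrite ge0_integralZl_EFin //; last 2 first.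
  - by apply: measurableT_comp => //; exact/measurable_EFinP.
  - by rewrite !mulr_ge0 ?cphi_ge0 // exprn_ge0.
  by rewrite lte_mul_pinfty // lee_fin !mulr_ge0 ?cphi_ge0 // exprn_ge0.
have iconv x : mu.-integrable setT (fun y => (dilate phi t (x - y)%R * g y)%:E).
  apply: (@le_integrable _ _ _ _ _ measurableT _ (fun y => (t ^- n * cphi)%:E * (g y)%:E)).
  - have h : measurable_fun setT (fun y : E => (x - y)%R).
      by have := measurable_dilate1 (-1)%R x; under eq_fun do rewrite scaleN1r.
    apply/measurable_EFinP; apply: measurable_funM => //.
    exact: (measurableT_comp mdil h).
  - move=> y _ /=; rewrite lee_fin !normrM ler_wpM2r //.
    rewrite (ger0_norm ti0) (ger0_norm cphi_ge0) ler_wpM2l //.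
    apply: (le_trans (phib _)); rewrite indicE; case: (_ \in _); rewrite ?mulr1 ?mulr0 //.
    exact: cphi_ge0.
  - exact: integrableZl.
transitivity (\int[mu]_x \int[mu]_z H (x, z)); last first.
  by apply: eq_integral => x _; rewrite -integralZl.
rewrite (Fubini iH); apply: eq_integral => z _.
have iz : mu.-integrable setT (fun x => H (x, z)).
  apply/integrableP; split; first exact: (measurable_fun_pair1 z mH).
  by apply: (le_lt_trans (inner z)); rewrite -EFinM ltry.
have := integral_dilate z t0 iz => h.
have {h} -> : \int[mu]_x H (x, z) = (t ^+ n)%:E * \int[mu]_y H (z + t *: y, z)%R.
  by rewrite h muleA -EFinM divff ?gt_eqF // mul1e.
rewrite muleC EFinM EFin_mollify // -integralZr //; last first.
  exact: (integrable_phiM (bdd_meas_dilate t z bF)).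
rewrite muleC -integralZl //; last first.
  apply: eq_integrable (integrableZl measurableT (t ^- n * g z)%R (integrable_phiM (bdd_meas_dilate t z bF))) => //.
  by move=> y _; rewrite /H /= dilE -EFinM; congr EFin; ring.
apply: eq_integral => y _; rewrite /H /= dilE -!EFinM; congr EFin.
by field; rewrite gt_eqF.
Qed.

End mollification.

(** * Increments along coordinate lines *)

Section line_derivative.
Context {R : realType} {n : nat}.
Local Notation E := 'rV[R]_n.
Local Notation leb := (@lebesgue_measure R).

(** The difference quotients along the line coincide with those of [f] in the direction [v], so the
    chain rule is reduced to one variable. *)
Lemma is_derive_line (f : E -> R) (v p : E) (s : R) :
  derivable f (p + s *: v) v ->
  is_derive s 1 (fun s => f (p + s *: v)) ('D_v f (p + s *: v)).
Proof.
move=> df.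
have eqf : (fun h => h^-1 *: (((fun s => f (p + s *: v)) \o shift s) (h *: 1) - f (p + s *: v))) =
    (fun h => h^-1 *: ((f \o shift (p + s *: v)) (h *: v) - f (p + s *: v))) :> (R -> R).
  apply/funext => h /=; congr (_ *: (f _ - _)).
  by rewrite scalerDl addrCA [h *: 1]mulr1.
split; first by rewrite /derivable eqf.
by rewrite /derive eqf.
Qed.

(** Fundamental theorem of calculus along t -> p + t c e_i. The number [c] stands for a coordinate
    of a point of the unit cube, so the factor |c| of the derivative is bounded by 1. *)
Lemma line_increment_le (f : E -> R) (i : 'I_n) (p : E) (c a b : R) :
  (forall x, derivable f x (delta_mx ord0 i)) -> continuous (partial i f) ->
  b < a -> `|c| <= 1 ->
  (`|f (p + (a * c) *: delta_mx ord0 i) - f (p + (b * c) *: delta_mx ord0 i)|%:E <=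
   \int[leb]_(t in `[b, a]) `|partial i f (p + (t * c) *: delta_mx ord0 i)|%:E)%E.
Proof.
move=> df cf ba c1; set e := delta_mx ord0 i.
pose F (t : R) : R := f (p + (t * c) *: e).
pose G (t : R) : R := partial i f (p + (t * c) *: e) * c.
have dF (t : R) : is_derive t 1 F (G t).
  apply: (@is_derive1_comp _ (fun s => f (p + s *: e)) (fun t => t * c)).
    exact: is_derive_line.
  have h : is_derive t 1 ((fun t : R => t) \* cst c) (t *: 0 + c *: 1).
    exact: is_deriveM.
  by apply: is_derive_eq h _; rewrite scaler0 add0r [c *: 1]mulr1.
have cp : continuous (fun t : R => partial i f (p + (t * c) *: e)).
  move=> t; apply: (@continuous_comp _ _ _ (fun t : R => p + (t * c) *: e) (partial i f)); last exact: cf.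
  apply: cvgD; first exact: cvg_cst.
  apply: cvgZl; apply: cvgM; [exact: cvg_id|exact: cvg_cst].
have cG : continuous G by move=> t; apply: cvgM; [exact: cp|exact: cvg_cst].
have cF : continuous F.
  move=> t; apply: differentiable_continuous; apply/derivable1_diffP.
  by have [] := dF t.
have mG : measurable_fun `[b, a] (EFin \o G).
  apply/measurable_EFinP; apply: measurable_funTS.
  exact: continuous_measurable_fun.
have mp : measurable_fun `[b, a] (fun t => `|partial i f (p + (t * c) *: e)|%:E : \bar R).
  apply/measurable_EFinP; apply: measurable_funTS; apply: measurableT_comp => //.
  exact: continuous_measurable_fun.
have := @continuous_FTC2 _ G F b a ba (continuous_subspaceT cG).
rewrite -EFinB => H.
have {}H : (\int[leb]_(x in `[b, a]) (G x)%:E)%E = (F a - F b)%:E.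
  apply: H.
    split => [t _||]; first by have [] := dF t.
      by apply: cvg_at_right_filter; exact: cF.
    by apply: cvg_at_left_filter; exact: cF.
  by move=> t _; rewrite derive1E; have [] := dF t.
rewrite -abse_EFin -H; apply: le_trans (le_abse_integral _ _ _) _ => //.
apply: ge0_le_integral => //.
- exact: measurableT_comp.
move=> t _; rewrite abse_EFin lee_fin /G normrM.
by rewrite -[leRHS]mulr1 ler_wpM2l.
Qed.

Lemma normr_le_enorm (x : E) (i : 'I_n) : `|x ord0 i| <= enorm x.
Proof.
rewrite /enorm -sqrtr_sqr ler_sqrt; last by apply: sumr_ge0 => j _; exact: sqr_ge0.
by rewrite (bigD1 i) //= lerDl; apply: sumr_ge0 => j _; exact: sqr_ge0.
Qed.

Lemma measurable_enorm : measurable_fun setT (@enorm R n).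
Proof.
apply: (measurableT_comp (continuous_measurable_fun (@sqrt_continuous R))).
apply: measurable_sum => i; apply: measurable_funX.
exact: measurable_rV_coord.
Qed.

End line_derivative.

(** * Mollifications bounded by averages over cubes *)

Section mollification_bounds.
Context {R : realType} {n : nat}.
Local Notation E := 'rV[R]_n.
Local Notation mu := (lebesgue_rV R n).
Local Notation leb := (@lebesgue_measure R).
Local Open Scope ereal_scope.

(** Substituting z = d y coordinatewise: the upper bound [t] on the factors keeps the image inside
    [cube t], the lower bound [b] controls the Jacobian. *)
Lemma cube1_dmap_le (d x : E) (b t : R) (u : E -> \bar R) :
  measurable_fun setT u -> (forall z, 0 <= u z) -> (0 < b)%R ->
  (forall i, b <= d ord0 i <= t)%R ->
  \int[mu]_y ((\1_(cube 1) y)%:E * u (dmap d x y)) <= (b ^- n)%:E * cubeI t u x.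
Proof.
move=> mu0 u0 b0 dbt.
have d0 i : (0 < d ord0 i)%R by apply: lt_le_trans b0 _; have /andP[] := dbt i.
have mi r : measurable_fun setT (fun y : E => (\1_(cube r) y)%:E : \bar R).
  by apply/measurable_EFinP; apply: measurable_indic; exact: measurable_cube.
pose G z := (\1_(cube t) z)%:E * u (x + z)%R.
have mG : measurable_fun setT G.
  by apply: emeasurable_funM => //; apply: (measurableT_comp mu0); exact: measurable_addrVl.
have G0 z : 0 <= G z by rewrite mule_ge0 // lee_fin.
apply: (@le_trans _ _ (\int[mu]_y G (dmap d 0 y))).
  apply: ge0_le_integral => //.
  - by move=> y _; rewrite mule_ge0 // lee_fin.
  - apply: emeasurable_funM => //; apply: (measurableT_comp mu0).
    exact: measurable_dmap.
  - by apply: (measurableT_comp mG); exact: measurable_dmap.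
  move=> y _; rewrite /G.
  have -> : (x + dmap d 0 y = dmap d x y)%R.
    by apply/rowP => i; rewrite !mxE addr0 addrC.
  apply: lee_wpmul2r => //; rewrite lee_fin !indicE ler_nat.
  case: (boolP (y \in cube 1)) => // /set_mem h; rewrite mem_set // => i.
  rewrite mxE mxE addr0 normrM gtr0_norm //.
  have /andP[_ dt] := dbt i; apply: lt_le_trans dt.
  by rewrite -[ltRHS]mulr1 ltr_pM2l //; exact: h.
rewrite ge0_integral_dmap //; last by move=> i; rewrite gt_eqF.
apply: lee_wpmul2r; first exact: integral_ge0.
rewrite lee_fin -exprVn -[X in (_ <= _ ^+ X)%R]card_ord -prodr_const.
apply: ler_prod => i _; rewrite invr_ge0 normr_ge0 /= gtr0_norm // lef_pV2 ?posrE //.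
by have /andP[] := dbt i.
Qed.

Variables (phi : E -> R) (cphi : R).
Hypothesis mphi : measurable_fun setT phi.
Hypothesis phib : forall y, (`|phi y| <= cphi * \1_(cube 1) y)%R.

Lemma mollify_abs_le (t : R) (F : E -> R) x : (0 < t)%R -> bdd_meas F ->
  `|mollify phi t F x|%:E <= (cphi * t ^- n)%:E * cubeI t (fun z => `|F z|%:E) x.
Proof.
move=> t0 bF; apply: (le_trans (phiM_abs_le mphi phib (bdd_meas_dilate t x bF))).
rewrite EFinM -muleA; apply: lee_wpmul2l; first by rewrite lee_fin (cphi_ge0 phib).
under eq_integral do rewrite -dmap_const.
apply: (@cube1_dmap_le (const_mx t) x t t (fun z => `|F z|%:E)) => //.
  by apply/measurable_EFinP; apply: measurableT_comp => //; case: bF.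
by move=> i; rewrite mxE lexx.
Qed.

(* Moving from (t/2) y to t y one coordinate at a time only uses the partial
   derivatives along coordinate lines, so no differentiability is needed. *)
Lemma mollify_half_le (t : R) (f : E -> R) x : (0 < t)%R -> bdd_meas f ->
  (forall i x, derivable f x (delta_mx ord0 i)) ->
  (forall i, continuous (partial i f)) ->
  `|mollify phi (t / 2) f x - mollify phi t f x|%:E <=
  (cphi * n%:R * 2 ^+ n * (t * t ^- n))%:E * cubeI t (fun z => (enorm (grad f z))%:E) x.
Proof.
move=> t0 bf df cf; set u := fun z => (enorm (grad f z))%:E.
have b0 : (0 < t / 2)%R by rewrite divr_gt0.
have bt : (t / 2 < t)%R by rewrite ltr_pdivrMr // mulr_natr mulr2n ltrDl.
set b := (t / 2)%R in b0 bt *.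
have u0 z : 0 <= u z by rewrite lee_fin sqrtr_ge0.
have mgrad : measurable_fun setT (grad f).
  apply: measurable_fun_rVP => i.
  rewrite (_ : _ \o _ = partial i f); first exact: continuous_measurable_rV.
  by apply/funext => z; rewrite /= /rV_coord mxE.
have mu0 : measurable_fun setT u.
  by apply/measurable_EFinP; apply: (measurableT_comp measurable_enorm mgrad).
have mi r : measurable_fun setT (fun y : E => (\1_(cube r) y)%:E : \bar R).
  by apply/measurable_EFinP; apply: measurable_indic; exact: measurable_cube.
(* In [e k] the first k coordinates have already moved from t/2 to t. In [d i s] the coordinate i is
   on its way, at [s], so that [d i b] and [d i t] are [e i] and [e i.+1]. *)
pose e (k : nat) : E := (\row_j (if (j < k)%N then t else b))%R.
pose d (i : 'I_n) (s : R) : E := (\row_j (if (j < i)%N then t else if j == i then s else b))%R.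
pose H (i : 'I_n) (p : E * R) : \bar R :=
  (\1_(cube 1) p.1)%:E * ((\1_(`[b, t]%classic : set R) p.2)%:E * u (dmap (d i p.2) x p.1)).
have H0 i p : 0 <= H i p by rewrite !mule_ge0 // lee_fin.
have mT : measurable_fun setT (fun s : R => (\1_(`[b, t]%classic : set R) s)%:E : \bar R).
  by apply/measurable_EFinP; apply: measurable_indic.
have mdm i : measurable_fun setT (fun p : E * R => dmap (d i p.2) x p.1).
  apply: measurable_fun_rVP => j.
  rewrite (_ : _ \o _ = fun p : E * R =>
    ((if (j < i)%N then t else if j == i then p.2 else b) * rV_coord j p.1 + x ord0 j)%R).
    apply: measurable_funD => //; apply: measurable_funM.
      by case: (j < i)%N => /=; [exact: measurable_cst|case: (j == i) => /=; [exact: measurable_snd|exact: measurable_cst]].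
    exact: (measurableT_comp (measurable_rV_coord j)).
  by apply/funext => p; rewrite /= /rV_coord !mxE.
have mH i : measurable_fun setT (H i).
  apply: emeasurable_funM; first exact: (measurableT_comp (mi 1%R)).
  apply: emeasurable_funM; first exact: (measurableT_comp mT).
  exact: (measurableT_comp mu0 (mdm i)).
pose G (y : E) : R := (f (x + b *: y) - f (x + t *: y))%R.
have gE i z : (`|partial i f z| <= enorm (grad f z))%R.
  by have := normr_le_enorm (grad f z) i; rewrite mxE.
have bG : bdd_meas G by apply: bdd_measB; exact: bdd_meas_dilate.
have -> : (mollify phi b f x - mollify phi t f x = \int[mu]_y (phi y * G y))%R.
  rewrite /mollify -RintegralB //; last 2 first.
  - exact: (integrable_phiM mphi phib (bdd_meas_dilate b x bf)).
  - exact: (integrable_phiM mphi phib (bdd_meas_dilate t x bf)).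
  by apply: eq_Rintegral => y _; rewrite mulrBr.
apply: (le_trans (phiM_abs_le mphi phib bG)).
rewrite -!mulrA EFinM -muleA; apply: lee_wpmul2l; first by rewrite lee_fin (cphi_ge0 phib).
apply: (@le_trans _ _ (\int[mu]_y \sum_(i < n) \int[leb]_s H i (y, s))).
  have mHi i : measurable_fun setT (fun y => \int[leb]_s H i (y, s)).
    exact: (@measurable_fun_fubini_tonelli_F _ _ _ _ _ leb (H i) (mH i) (H0 i)).
  apply: ge0_le_integral => //.
  - apply: emeasurable_funM => //; apply/measurable_EFinP.
    by apply: measurableT_comp => //; case: bG.
  - by apply: emeasurable_sum => i; exact: mHi.
  move=> y _; case: (boolP (y \in cube 1)) => [hy|/negbTE hy]; last first.
    by rewrite indicE hy mul0e sume_ge0 // => i _; exact: integral_ge0.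
  rewrite indicE hy mul1e; move/set_mem : hy => hy.
  have -> : `|G y|%R = `|\sum_(i < n) (f (dmap (d i t) x y) - f (dmap (d i b) x y))|%R.
    rewrite distrC; congr (`|_|%R).
    transitivity (\sum_(0 <= k < n) (f (dmap (e k.+1) x y) - f (dmap (e k) x y)))%R.
      rewrite telescope_sumr //; congr (f _ - f _)%R; apply/rowP => j; rewrite !mxE.
        by rewrite ltn_ord addrC.
      by rewrite addrC.
    rewrite big_mkord; apply: eq_bigr => i _; congr (f _ - f _)%R; apply/rowP => j; rewrite !mxE.
      by rewrite ltnS leq_eqVlt -val_eqE /=; case: (ltngtP j i).
    by rewrite -val_eqE /=; case: (ltngtP j i).
  apply: (@le_trans _ _ (\sum_(i < n) `|f (dmap (d i t) x y) - f (dmap (d i b) x y)|%R%:E)).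
    by rewrite sumEFin lee_fin ler_norm_sum.
  apply: lee_sum => i _.
  have dE s : dmap (d i s) x y = (dmap (d i 0) x y + (s * y ord0 i) *: delta_mx ord0 i)%R.
    apply/rowP => j; rewrite !mxE eqxx /=.
    have [->|ji] := eqVneq j i; first by rewrite ltnn mul0r add0r mulr1 addrC.
    by rewrite mulr0 addr0.
  rewrite (dE t) (dE b); apply: (le_trans (line_increment_le _ (df i) (cf i) bt (ltW (hy i)))).
  rewrite integral_mkcond; apply: ge0_le_integral => //.
  - by move=> s _; rewrite patchE; case: ifP => //; rewrite lee_fin.
  - apply/(measurable_restrictT _ _).1 => //; apply: measurable_funTS.
    apply/measurable_EFinP; apply: measurableT_comp => //.
    under eq_fun do rewrite -dE.
    have := continuous_measurable_rV (cf i) => mp.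
    apply: (measurableT_comp mp).
    exact: (measurable_fun_pair2 y (mdm i)).
  - exact: (measurable_fun_pair2 y (mH i)).
  move=> s _; rewrite patchE /H /= !indicE (mem_set hy) mul1e.
  case: ifP => _; last by rewrite mul0e.
  rewrite mul1e (dE s) lee_fin; exact: gE.
rewrite ge0_integral_sum //; last 2 first.
- by move=> i; exact: (@measurable_fun_fubini_tonelli_F _ _ _ _ _ leb (H i) (mH i) (H0 i)).
- by move=> i y _; exact: integral_ge0.
have cI0 : 0 <= cubeI t u x by exact: cubeI_ge0.
have tn0 : (0 < t ^+ n)%R by rewrite exprn_gt0.
have tm0 : (0 <= t ^- n)%R by rewrite invr_ge0 ltW.
have bn0 : (0 <= b ^- n)%R by rewrite invr_ge0 exprn_ge0 // ltW.
(* The factor t bounds the length of [t/2, t], and b^-n = 2^n t^-n bounds the Jacobian for every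
   position s of the moving coordinate; the n coordinates account for the factor n. *)
apply: (@le_trans _ _ (\sum_(i < n) ((t * b ^- n)%:E * cubeI t u x))).
  apply: lee_sum => i _.
  rewrite [leLHS](_ : _ = \int[leb]_s \int[mu]_y H i (y, s)); last first.
    have FT := @fubini_tonelli _ _ _ _ _ mu leb (H i) (mH i) (H0 i).
    exact: FT.
  have K0 : 0 <= (b ^- n)%:E * cubeI t u x by rewrite mule_ge0.
  apply: (@le_trans _ _ (\int[leb]_s ((\1_(`[b, t]%classic : set R) s)%:E * ((b ^- n)%:E * cubeI t u x)))).
    apply: ge0_le_integral => //.
    - by move=> s _; exact: integral_ge0.
    - exact: (@measurable_fun_fubini_tonelli_G _ _ _ _ _ mu (H i) (mH i) (H0 i)).
    - exact: emeasurable_funM.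
    move=> s _; rewrite /H /=.
    have [sI|sI] := boolP (s \in (`[b, t]%classic : set R)); last first.
      rewrite indicE (negbTE sI) mul0e.
      by under eq_integral do rewrite mul0e mule0; rewrite integral0.
    rewrite indicE sI mul1e; under eq_integral do rewrite mul1e.
    apply: cube1_dmap_le => // j; rewrite mxE.
    move/set_mem : sI; rewrite /= in_itv /= => /andP[s1 s2].
    by case: ifP => _; [rewrite lexx ltW|case: ifP => _; rewrite ?s1 ?s2 // lexx ltW].
  rewrite ge0_integralZr //.
  have -> : \int[leb]_s (\1_(`[b, t]%classic : set R) s)%:E = (t - b)%:E.
    rewrite integral_indic // setIT.
    by have := lebesgue_measure_itv `[b, t]; rewrite /= lte_fin bt.
  rewrite muleA -EFinM; apply: lee_wpmul2r => //; rewrite lee_fin ler_wpM2r //.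
  by rewrite lerBlDr lerDl ltW.
rewrite -ge0_sume_distrl => [|i _]; last by rewrite lee_fin mulr_ge0 // ltW.
apply: lee_wpmul2r => //; rewrite sumEFin sumr_const card_ord lee_fin.
rewrite mulr_natl lerMn2r; apply/orP; right.
rewrite (_ : b ^- n = 2 ^+ n * t ^- n)%R; first by rewrite mulrCA.
by rewrite /b expr_div_n invf_div.
Qed.

End mollification_bounds.

(** * Convergence of mollifications and the Morrey bound *)

Section hardy_morrey_bounds.
Context {R : realType} {n : nat}.
Local Notation E := 'rV[R]_n.
Local Notation mu := (lebesgue_rV R n).

Lemma compact_supp_bdd (f : E -> R) : continuous f -> compact (supp f) ->
  exists B : R, forall x, `|f x| <= B.
Proof.
move=> cf cK.
have /compact_bounded [M [_ hM]] : compact (f @` supp f).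
  by apply: continuous_compact => //; exact: continuous_subspaceT.
exists (`|M| + 1) => x.
have [->|fx] := eqVneq (f x) 0; first by rewrite normr0 addr_ge0.
apply: (hM (`|M| + 1)); first by rewrite (le_lt_trans (ler_norm _)) // ltrDl.
by exists x => //; exact: subset_closure.
Qed.

Lemma Ccinfty_bdd_meas (f : E -> R) : Ccinfty f -> bdd_meas f.
Proof.
move=> [sf cK]; have [cf _] := sf [::]; split; first exact: continuous_measurable_rV.
exact: compact_supp_bdd.
Qed.

Lemma measurable_eball (x : E) (r : R) : measurable (eball x r).
Proof.
have h : measurable_fun setT (fun y : E => enorm (y - x)).
  apply: (measurableT_comp measurable_enorm).
  by under eq_fun do rewrite addrC; exact: measurable_addrVl.
rewrite (_ : eball x r = setT `&` (fun y : E => enorm (y - x)) @^-1` [set` `]-oo, r[]).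
  exact: h.
by apply/seteqP; split=> y /=; rewrite in_itv /=; [move=> ?; split|case].
Qed.

Lemma enormZ (t : R) (x : E) : enorm (t *: x) = `|t| * enorm x.
Proof.
rewrite /enorm -(sqrtr_sqr t) -sqrtrM ?sqr_ge0 // mulr_sumr; congr Num.sqrt.
by apply: eq_bigr => i _; rewrite mxE exprMn.
Qed.

Lemma cube_near (x : E) (t : R) : 0 <= t -> forall y z : E, cube 1 y -> cube 1 z ->
  `|x - (x + t *: y + t *: z)| <= 2 * t.
Proof.
move=> t0 y z hy hz; rewrite /Num.norm /= mx_normrE.
apply: bigmax_le => [|[i j] _ /=]; first exact: mulr_ge0.
rewrite ord1 !mxE.
rewrite (_ : x ord0 j - (x ord0 j + t * y ord0 j + t * z ord0 j) = - (t * (y ord0 j + z ord0 j))); last by ring.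
rewrite normrN normrM ger0_norm // mulrC ler_wpM2r //.
apply: le_trans (ler_normD _ _) _.
by have := ltW (hy j); have := ltW (hz j); lra.
Qed.

Lemma scale_cvg0 : (@scale R) @ \oo --> (0 : R).
Proof.
have h : (fun k => (2^-1 : R) ^+ k) @ \oo --> (0 : R).
  by apply: cvg_expr; rewrite ger0_norm ?invr_ge0 // invf_lt1 // ltr1n.
by move: h; rewrite -cvg_shiftS.
Qed.

Section fixed_mollifier.
Variables (phi : E -> R) (cphi : R).
Hypothesis mphi : measurable_fun setT phi.
Hypothesis phib : forall y, (`|phi y| <= cphi * \1_(cube 1) y)%R.
Hypothesis phi_ball : forall y, phi y != 0 -> enorm y < 1.

(** Each mollification multiplies the limit by int phi and the error by at most L. Together they
    displace the point by at most 2 t in the sup norm, whence t <= d / 4 for the modulus of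
    continuity d. *)
Lemma mollify2_cvg (f : E -> R) x : bdd_meas f -> continuous f ->
  (fun k => mollify phi (scale k) (mollify phi (scale k) f) x) @ \oo -->
  (\int[mu]_y phi y) ^+ 2 * f x.
Proof.
move=> bf cf; apply/cvgrPdist_le => e e0.
pose L := cphi * 2 ^+ n.
have L0 : 0 <= L by rewrite mulr_ge0 ?exprn_ge0 // (cphi_ge0 phib).
have LL : 0 < L * L + 1 by rewrite ltr_wpDl // mulr_ge0.
pose e' := e / (L * L + 1).
have e'0 : 0 < e' by rewrite divr_gt0.
have /cvgrPdist_le/(_ _ e'0) := cf x.
rewrite -nbhs_ballE => -[d /= d0 hd].
have d40 : 0 < d / 4 by rewrite divr_gt0.
have /cvgrPdist_le/(_ _ d40) hs := scale_cvg0.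
near=> k.
have hsk : scale k <= d / 4.
  have : `|0 - scale k| <= d / 4 :> R by near: k; exact: hs.
  by rewrite sub0r normrN (ger0_norm (ltW (scale_gt0 k))).
have t0 := scale_gt0 (R := R) k; set t := scale k in hsk t0 *.
have near_le y z : cube 1 y -> cube 1 z -> `|f (x + t *: y + t *: z) - f x| <= e'.
  move=> hy hz; rewrite distrC; apply: hd.
  rewrite -ball_normE /=; apply: (le_lt_trans (cube_near _ (ltW t0) hy hz)).
  by lra.
set c := \int[mu]_y phi y.
rewrite distrC expr2 -mulrA.
apply: (@le_trans _ _ (L * (L * e'))).
  apply: (mollify_near mphi phib) => //; first by rewrite mulr_ge0 // ltW.
    exact: bdd_meas_mollify.
  move=> y hy; apply: (mollify_near mphi phib) => //; first exact: ltW.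
  by move=> z hz; exact: near_le.
rewrite /e' mulrA mulrCA -[leRHS]mulr1 ler_wpM2l ?(ltW e0) // ler_pdivrMr // mul1r lerDl.
exact: ler01.
Unshelve. all: by end_near. Qed.

Local Open Scope ereal_scope.

(** phi_t(x - .) is bounded by cphi t^-n and lives in the Euclidean ball of radius t, the kind of
    ball in the Morrey norm; then t^-n = t^-2 t^(2-n). *)
Lemma convolution_le_morrey (g : E -> R) (t : R) x : measurable_fun setT g -> (0 < t)%R ->
  `|convolution (dilate phi t) g x| <= (cphi * t ^- 2)%:E * morrey_norm g.
Proof.
move=> mg t0.
have c0 := cphi_ge0 phib.
have tn0 : (0 <= t ^- n)%R by rewrite invr_ge0 exprn_ge0 // ltW.
pose k y : \bar R := (((fun y => `|g y|%:E) : E -> \bar R) \_ (eball x t)) y.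
have mk : measurable_fun setT k.
  apply/(measurable_restrictT _ _).1; first exact: measurable_eball.
  by apply: measurable_funTS; apply/measurable_EFinP; exact: measurableT_comp.
have k0 y : 0 <= k y by rewrite /k patchE; case: ifP => // _; rewrite lee_fin.
have mdil : measurable_fun setT (fun y : E => dilate phi t (x - y)%R * g y)%R.
  apply: measurable_funM => //; apply: measurable_funM => //.
  apply: (measurableT_comp mphi).
  have h : measurable_fun setT (fun y : E => (x - y)%R).
    by have := measurable_dilate1 (-1)%R x; under eq_fun do rewrite scaleN1r.
  have := measurableT_comp (measurable_dilate1 t^-1 0) h.
  by rewrite (_ : _ \o _ = fun y => t^-1 *: (x - y))%R //; apply/funext => y /=; rewrite add0r.
apply: le_trans (le_abse_integral _ _ _) _ => //; first exact/measurable_EFinP.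
apply: (@le_trans _ _ (\int[mu]_y ((cphi * t ^- n)%:E * k y))).
  apply: ge0_le_integral => //.
  - by apply: measurableT_comp => //; exact/measurable_EFinP.
  - exact: emeasurable_funM.
  move=> y _; rewrite /k patchE abse_EFin normrM.
  have [->|p0] := eqVneq (dilate phi t (x - y)) 0%R.
    rewrite normr0 mul0r mule_ge0 ?lee_fin ?mulr_ge0 //.
    by case: ifP => // _; rewrite lee_fin.
  have {}p0 : phi (t^-1 *: (x - y))%R != 0%R.
    by apply: contra_neq p0 => p0; rewrite /dilate p0 mulr0.
  rewrite mem_set; last first.
    have := phi_ball p0; rewrite enormZ gtr0_norm ?invr_gt0 // mulrC ltr_pdivrMr // mul1r.
    rewrite /eball /= (_ : y - x = -1 *: (x - y))%R; last by rewrite scaleN1r opprB.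
    by rewrite enormZ normrN normr1 mul1r.
  rewrite -EFinM lee_fin ler_wpM2r // /dilate normrM ger0_norm // mulrC ler_wpM2r //.
  apply: le_trans (phib _) _; rewrite indicE; case: (_ \in _); rewrite ?mulr1 ?mulr0 //.
rewrite ge0_integralZl_EFin ?mulr_ge0 // -integral_mkcond.
rewrite [X in X%:E * _](_ : _ = (cphi * t ^- 2) * (t ^ (2%:Z - n%:Z)))%R; last first.
  by rewrite expfzDr ?gt_eqF // -exprnN -mulrA; congr (_ * _)%R; rewrite mulrA mulVf ?mul1r // expf_neq0 // gt_eqF.
rewrite EFinM -muleA; apply: lee_wpmul2l.
  by rewrite lee_fin mulr_ge0 // invr_ge0 exprn_ge0 // ltW.
apply: ereal_sup_ubound; exists x => //; exists t => //.
Qed.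

Lemma measurable_convolution (f g : E -> R) : measurable_fun setT f ->
  measurable_fun setT g -> measurable_fun setT (convolution f g).
Proof.
move=> mf mg; pose H (p : E * E) : \bar R := (f (p.1 - p.2) * g p.2)%:E.
have mH : measurable_fun setT H.
  apply/measurable_EFinP; apply: measurable_funM; last exact: (measurableT_comp mg).
  have h := @measurable_dilate2 R n (-1)%R.
  have {}h : measurable_fun setT (fun p : E * E => (p.1 - p.2)%R).
    by under eq_fun do rewrite -scaleN1r.
  exact: (measurableT_comp mf h).
rewrite (_ : convolution f g = (fun x => \int[mu]_y (H^\+ (x, y)) - \int[mu]_y (H^\- (x, y)))).
  apply: emeasurable_funB.
    apply: (@measurable_fun_fubini_tonelli_F _ _ _ _ _ mu) => //.
    exact: measurable_funepos.
  apply: (@measurable_fun_fubini_tonelli_F _ _ _ _ _ mu) => //.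
  exact: measurable_funeneg.
apply/funext => x; rewrite /convolution integralE.
by congr (_ - _); apply: eq_integral => y _; rewrite ?funeposE ?funenegE.
Qed.

Lemma integrable_bddM (F g : E -> R) : bdd_meas F -> mu.-integrable setT (EFin \o g) ->
  mu.-integrable setT (fun x => (F x * g x)%:E).
Proof.
move=> [mF [B FB]] ig.
have mg : measurable_fun setT g by apply/measurable_EFinP; exact: measurable_int ig.
apply: (@le_integrable _ _ _ _ _ measurableT _ (fun y => B%:E * (g y)%:E)).
- by apply/measurable_EFinP; exact: measurable_funM.
- move=> y _; rewrite -EFinM !abse_EFin lee_fin !normrM ler_wpM2r //.
  exact: le_trans (FB y) (ler_norm _).
- exact: integrableZl.
Qed.

(** The mollification goes over to [g] by adjunction, the pointwise bounds are inserted, and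
    symmetry moves the average from [v] to [b]. With [v] equal to |grad f| or |f|, only its L^2 norm
    is needed later, and all averages fall on the bounds for [g]. *)
Lemma pairing_le (g : E -> R) (s t c : R) (F : E -> R) (v b : E -> \bar R) :
  mu.-integrable setT (EFin \o g) -> (0 < s)%R -> (0 <= c)%R -> bdd_meas F ->
  measurable_fun setT v -> (forall x, 0 <= v x) ->
  measurable_fun setT b -> (forall x, 0 <= b x) ->
  (forall x, `|F x|%:E <= c%:E * cubeI t v x) ->
  (forall x, `|convolution (dilate phi s) g x| <= b x) ->
  `|\int[mu]_x (mollify phi s F x * g x)%:E| <= c%:E * \int[mu]_x (v x * cubeI t b x).
Proof.
move=> ig s0 c0 bF mv v0 mb b0 Fle Ble.
have [mF _] := bF.
have mI : measurable_fun setT (cubeI t v) by exact: measurable_cubeI.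
have I0 x : 0 <= cubeI t v x by exact: cubeI_ge0.
have iFg := integrable_bddM (bdd_meas_mollify mphi phib s bF) ig.
rewrite cubeI_sym //.
have mIb : measurable_fun setT (fun x => cubeI t v x * b x) by exact: emeasurable_funM.
have Ib0 x : setT x -> 0 <= cubeI t v x * b x by rewrite mule_ge0.
rewrite -(ge0_integralZl_EFin mu measurableT Ib0 mIb c0).
rewrite (mollify_adjoint mphi phib s0 bF ig).
pose G x := c%:E * (cubeI t v x * b x).
have mG : measurable_fun setT G by exact: emeasurable_funM.
have GE x : `|(F x)%:E * convolution (dilate phi s) g x| <= G x.
  by rewrite abseM /G muleA; apply: lee_pmul; [exact: abse_ge0|exact: abse_ge0|exact: Fle|exact: Ble].
have mg : measurable_fun setT g by apply/measurable_EFinP; exact: measurable_int ig.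
have mdil : measurable_fun setT (dilate phi s).
  apply: measurable_funM => //; apply: (measurableT_comp mphi).
  have := @measurable_dilate1 R n s^-1%R 0%R; by under eq_fun do rewrite add0r.
have mH : measurable_fun setT (fun x => (F x)%:E * convolution (dilate phi s) g x).
  apply: emeasurable_funM; first exact/measurable_EFinP.
  exact: measurable_convolution.
apply: le_trans (le_abse_integral _ measurableT mH) _.
apply: ge0_le_integral => //.
exact: measurableT_comp.
Qed.

End fixed_mollifier.
End hardy_morrey_bounds.

(** * The duality estimate *)

Section duality_estimate.
Context {R : realType} {n : nat}.
Local Notation E := 'rV[R]_n.
Local Notation mu := (lebesgue_rV R n).
Local Open Scope ereal_scope.

Lemma local_maximal_ge0 (phi g : E -> R) x : 0 <= local_maximal phi g x.
Proof.
apply: (@le_trans _ _ `|convolution (dilate phi 2^-1%R) g x|); first exact: abse_ge0.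
apply: ereal_sup_ubound; exists (2^-1)%R => //=.
by rewrite invr_gt0 ltr0n invf_lt1 // ltr1n.
Qed.

Variables (phi : E -> R) (cphi : R).
Hypothesis mphi : measurable_fun setT phi.
Hypothesis phib : forall y, (`|phi y| <= cphi * \1_(cube 1) y)%R.
Hypothesis phi_ball : forall y, phi y != 0%R -> (enorm y < 1)%R.
Variables (g : E -> R) (M : R).
Hypothesis ig : mu.-integrable setT (EFin \o g).
Hypothesis mh : measurable_fun setT (local_maximal phi g).
Hypothesis M0 : (0 <= M)%R.
Hypothesis gM : morrey_norm g = M%:E.
Variable f : E -> R.
Hypothesis bf : bdd_meas f.
Hypothesis df : forall i x, derivable f x (delta_mx ord0 i).
Hypothesis cf : forall i, continuous (partial i f).

Let h := local_maximal phi g.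
Let u z := (enorm (grad f z))%:E.
Let af z := `|f z|%:E.
Let b k x := mine (h x) (cphi * M / scale k ^+ 2)%:E.
Let X k x := (@swt R n k)%:E * cubeI (scale k) (b k) x.
Let c0 : (0 <= cphi)%R. Proof. exact: cphi_ge0 phib. Qed.
Let cM k : (0 <= cphi * M / scale k ^+ 2)%R.
Proof. by rewrite divr_ge0 ?mulr_ge0 // exprn_ge0 // ltW // scale_gt0. Qed.
Let h0 x : 0 <= h x. Proof. exact: local_maximal_ge0. Qed.
Let b0 k x : 0 <= b k x.
Proof. by rewrite /b le_min h0 lee_fin cM. Qed.
Let mb k : measurable_fun setT (b k).
Proof. exact: measurable_mine. Qed.
Let u0 z : 0 <= u z. Proof. by rewrite lee_fin sqrtr_ge0. Qed.
Let af0 z : 0 <= af z. Proof. by rewrite lee_fin. Qed.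
Let mu_u : measurable_fun setT u.
Proof.
apply/measurable_EFinP; apply: (measurableT_comp measurable_enorm).
apply: measurable_fun_rVP => i.
rewrite (_ : _ \o _ = partial i f); first exact: continuous_measurable_rV.
by apply/funext => z; rewrite /= /rV_coord mxE.
Qed.
Let maf : measurable_fun setT af.
Proof. by apply/measurable_EFinP; apply: measurableT_comp => //; case: bf. Qed.
Let X0 k x : 0 <= X k x.
Proof. by rewrite mule_ge0 ?lee_fin ?swt_ge0 // cubeI_ge0. Qed.
Let mX k : measurable_fun setT (X k).
Proof. by apply: emeasurable_funM => //; exact: measurable_cubeI. Qed.

Let bS k x : b k.+1 x <= 4%:E * b k x.
Proof.
rewrite /b scaleS (_ : cphi * M / (scale k / 2) ^+ 2 = 4 * (cphi * M / scale k ^+ 2))%R; last first.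
  by field; rewrite gt_eqF // scale_gt0.
have := cM k; set y := (cphi * M / scale k ^+ 2)%R => y0.
have [hy|hy] := leP (h x) y%:E.
  rewrite ge_min; apply/orP; left; rewrite -[leLHS]mul1e; apply: lee_wpmul2r => //.
  by rewrite lee_fin ler1n.
by rewrite ge_min EFinM lexx orbT.
Qed.

Let conv_le_b k x : `|convolution (dilate phi (scale k)) g x| <= b k x.
Proof.
have mg : measurable_fun setT g by apply/measurable_EFinP; exact: measurable_int ig.
rewrite /b le_min; apply/andP; split.
  apply: ereal_sup_ubound; exists (scale k) => //=.
  by rewrite scale_gt0 scale_le1.
apply: (le_trans (convolution_le_morrey mphi phib phi_ball _ mg (scale_gt0 k))).
by rewrite gM -EFinM lee_fin mulrAC.
Qed.

Let P k F := mollify phi (scale k) F.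
Let J F := \int[mu]_x (F x * g x)%:E.
(** 2 [cphi] pays for the coarsest term, the 2 undoing the factor t_0 = 1/2 in [swt 0]. In 5 = 4 + 1
    the two mollifications of a step are added; the one at the finer scale is bounded by b_{k+1} <=
    4 b_k. *)
Definition duality_cst : R := (2 * cphi + 5 * (cphi * n%:R * 2 ^+ n))%R.
Let C1 := duality_cst.

Let c20 : (0 <= cphi * n%:R * 2 ^+ n)%R.
Proof. by rewrite !mulr_ge0 // exprn_ge0. Qed.

Let pull k (v : E -> \bar R) : measurable_fun setT v -> (forall x, 0 <= v x) ->
  (@swt R n k)%:E * \int[mu]_x (v x * cubeI (scale k) (b k) x) = \int[mu]_x (v x * X k x).
Proof.
move=> mv v0.
have mI : measurable_fun setT (cubeI (scale k) (b k)) by exact: measurable_cubeI.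
have I0 x : 0 <= cubeI (scale k) (b k) x by exact: cubeI_ge0.
rewrite -ge0_integralZl_EFin ?swt_ge0 //.
- by apply: eq_integral => x _; rewrite muleCA.
- by move=> x _; rewrite mule_ge0.
- exact: emeasurable_funM.
Qed.

(** At the coarsest scale there is no difference to exploit: the remaining mollification of [f] is
    bounded by an average of |f|. *)
Let base_le : `|J (P 0 (P 0 f))| <= (2 * cphi)%:E * \int[mu]_x (af x * X 0%N x).
Proof.
have t0 := scale_gt0 (R := R) 0.
have ti0 : (0 <= scale 0 ^- n :> R)%R by rewrite invr_ge0 exprn_ge0 // ltW.
apply: (le_trans (@pairing_le _ _ phi cphi mphi phib g (scale 0) (scale 0)
  (cphi * scale 0 ^- n)%R (P 0 f) af (b 0%N) _ _ _ _ _ _ _ _ _ _)) => //.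
- by rewrite mulr_ge0.
- exact: bdd_meas_mollify.
- by move=> x; exact: (mollify_abs_le mphi phib).
rewrite -pull // muleA -EFinM.
rewrite (_ : 2 * cphi * @swt R n 0 = cphi * scale 0 ^- n)%R //.
rewrite /swt exprVn; set p := (_ ^- n)%R.
by rewrite /scale expr1; field.
Qed.

Let sq_diff s t x :
  mollify phi s (mollify phi s f) x = (mollify phi t (mollify phi t f) x +
    (mollify phi s (fun x => mollify phi s f x - mollify phi t f x) x +
     mollify phi t (fun x => mollify phi s f x - mollify phi t f x) x))%R.
Proof.
have bs := bdd_meas_mollify mphi phib s bf.
have bt := bdd_meas_mollify mphi phib t bf.
(* With S and T the mollifications at scales s and t, [a] is S S f, [d] is T T f, [p] is S T f and
   [q] is T S f; commutation is the equation p = q. *)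
have alg (a d p q e1 e2 : R) : (e1 = a - p -> e2 = q - d -> p = q -> a = d + (e1 + e2))%R.
  by move=> -> -> ->; ring.
exact: (alg _ _ _ _ _ _ (mollifyB mphi phib s x bs bt) (mollifyB mphi phib t x bs bt)
  (mollifyC mphi phib s t x bf)).
Qed.

Let step_le k : `|J (P k.+1 (P k.+1 f))| <= `|J (P k (P k f))| +
  (5 * (cphi * n%:R * 2 ^+ n))%:E * \int[mu]_x (u x * X k x).
Proof.
have bP i F : bdd_meas F -> bdd_meas (P i F) by exact: bdd_meas_mollify.
pose D x := (P k.+1 f x - P k f x)%R.
have bD : bdd_meas D by apply: bdd_measB; exact: bP.
have i1 := integrable_bddM (bP k _ (bP k _ bf)) ig.
have i2 := integrable_bddM (bP k.+1 _ bD) ig.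
have i3 := integrable_bddM (bP k _ bD) ig.
have JE : J (P k.+1 (P k.+1 f)) = J (P k (P k f)) + (J (P k.+1 D) + J (P k D)).
  rewrite /J -(integralD measurableT i2 i3) -(integralD measurableT i1); last first.
    exact: (integrableD measurableT i2 i3).
  apply: eq_integral => x _; rewrite -!EFinD; congr EFin.
  by rewrite /P (sq_diff (scale k.+1) (scale k) x) !mulrDl.
have key (x y z w v : \bar R) : x = y + (z + w) -> `|z| + `|w| <= v -> `|x| <= `|y| + v.
  move=> -> zw; apply: (le_trans (lee_abs_add _ _)); apply: leeD => //.
  exact: le_trans (lee_abs_add _ _) zw.
apply: (key _ _ _ _ _ JE).
have t0 i := ltW (scale_gt0 (R := R) i).
have sw0 := @swt_ge0 R n k.
have Dle x : `|D x|%:E <= (cphi * n%:R * 2 ^+ n * @swt R n k)%:E * cubeI (scale k) u x.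
  rewrite /D /P scaleS (_ : @swt R n k = scale k * scale k ^- n)%R; last by rewrite /swt exprVn.
  exact: (mollify_half_le mphi phib x (scale_gt0 k) bf df cf).
have cs0 : (0 <= cphi * n%:R * 2 ^+ n * @swt R n k)%R by rewrite mulr_ge0.
have e1 : `|J (P k.+1 D)| <= (4 * (cphi * n%:R * 2 ^+ n))%:E * \int[mu]_x (u x * X k x).
  have m4b : measurable_fun setT (fun x => 4%:E * b k x) by exact: emeasurable_funM.
  have := @pairing_le _ _ phi cphi mphi phib g (scale k.+1) (scale k)
    (cphi * n%:R * 2 ^+ n * @swt R n k)%R D u (fun x => 4%:E * b k x) ig (scale_gt0 _) cs0 bD mu_u u0 m4b.
  move=> H; apply: (le_trans (H _ Dle _)).
  - by move=> x; rewrite mule_ge0.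
  - by move=> x; apply: le_trans (bS k x); exact: conv_le_b.
  rewrite -pull // muleA -EFinM.
  have mI : measurable_fun setT (cubeI (scale k) (b k)) by exact: measurable_cubeI.
  have I0 x : 0 <= cubeI (scale k) (b k) x by exact: cubeI_ge0.
  under eq_integral do rewrite cubeIZ // muleCA.
  rewrite ge0_integralZl_EFin //; last 2 first.
  - by move=> x _; rewrite mule_ge0.
  - exact: emeasurable_funM.
  rewrite muleA -EFinM (_ : cphi * n%:R * 2 ^+ n * @swt R n k * 4 = 4 * (cphi * n%:R * 2 ^+ n) * @swt R n k)%R //.
  by ring.
have e2 : `|J (P k D)| <= (cphi * n%:R * 2 ^+ n)%:E * \int[mu]_x (u x * X k x).
  have := @pairing_le _ _ phi cphi mphi phib g (scale k) (scale k)
    (cphi * n%:R * 2 ^+ n * @swt R n k)%R D u (b k) ig (scale_gt0 _) cs0 bD mu_u u0 (mb k).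
  move=> /(_ (b0 k) Dle (conv_le_b k)) H; apply: (le_trans H).
  by rewrite -pull // muleA -EFinM.
have alg (I : \bar R) (c : R) : 0 <= I -> (0 <= c)%R ->
    (4 * c)%:E * I + c%:E * I <= (5 * c)%:E * I.
  move=> I0 c0'; rewrite -ge0_muleDl ?lee_fin ?mulr_ge0 // -EFinD.
  by rewrite (_ : 4 * c + c = 5 * c)%R //; ring.
apply: (le_trans (leeD e1 e2)); apply: alg => //.
by apply: integral_ge0 => x _; rewrite mule_ge0.
Qed.

Let sum_le k : `|J (P k (P k f))| <= C1%:E *
  (\int[mu]_x (af x * X 0%N x) + \sum_(i < k) \int[mu]_x (u x * X i x)).
Proof.
have I1 : 0 <= \int[mu]_x (af x * X 0%N x) by apply: integral_ge0 => x _; rewrite mule_ge0.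
have I2 i : 0 <= \int[mu]_x (u x * X i x) by apply: integral_ge0 => x _; rewrite mule_ge0.
elim: k => [|k IH].
  rewrite big_ord0 adde0; apply: (le_trans base_le); apply: lee_wpmul2r => //.
  by rewrite lee_fin /C1 /duality_cst lerDl mulr_ge0.
have key (a s i j : \bar R) (c d : R) : 0 <= a -> 0 <= s -> 0 <= i -> (c <= d)%R ->
    j <= d%:E * (a + s) -> j + c%:E * i <= d%:E * (a + (s + i)).
  move=> a0 s0 i0 cd jas; rewrite addeA ge0_muleDr ?adde_ge0 //; apply: leeD => //.
  by apply: lee_wpmul2r => //; rewrite lee_fin.
apply: (le_trans (step_le k)); rewrite big_ord_recr /=.
have s0 : 0 <= \sum_(i < k) \int[mu]_x (u x * X i x) by apply: sume_ge0 => i _; exact: I2.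
have cC : (5 * (cphi * n%:R * 2 ^+ n) <= C1)%R by rewrite /C1 /duality_cst lerDr mulr_ge0.
exact: (key _ _ _ _ _ _ I1 s0 (I2 k) cC IH).
Qed.

Definition square_cst : R :=
  (2 * (2 * (16 * (2 ^+ n) ^+ 2) ^+ 2 + 32 * (2 ^+ n) ^+ 3))%R.
Let C2 := square_cst.
Let C20 : (0 <= C2)%R.
Proof. by rewrite /C2 /square_cst !(mulr_ge0, addr_ge0, exprn_ge0). Qed.

(** The pairing is at most int w S with w = |f| + |grad f|, and int w^2 <= 2 by (a + d)^2 <= 2 (a^2
    + d^2). The parameter [l] stays free and the bound does not depend on [k]. *)
Let mollified_pairing_le (l Y : R) k : (0 < l)%R -> \int[mu]_x h x = Y%:E ->
  \int[mu]_x (f x ^+ 2)%:E + \int[mu]_x (enorm (grad f x) ^+ 2)%:E <= 1 ->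
  `|J (P k (P k f))| <= (C1 * (2 * l + l^-1 * (C2 * (16 * (cphi * M) * Y))))%:E.
Proof.
move=> l0 hY f1.
have li0 : (0 <= l^-1)%R by rewrite invr_ge0 ltW.
have C10 : (0 <= C1)%R by rewrite /C1 /duality_cst addr_ge0 ?mulr_ge0.
(* With [k.+1] scales, index 0 is present even for k = 0, so that S dominates both the coarsest term
   and the sum over i < k. *)
pose S := Sfun (n := n) k.+1 b; pose W := Wfun (n := n) k.+1 b.
have S0 x : 0 <= S x by exact: Sfun_ge0.
have mS : measurable_fun setT S by exact: measurable_Sfun.
have W0 x : 0 <= W x by exact: Wfun_ge0.
have mW : measurable_fun setT W by exact: measurable_Wfun.
pose w x := af x + u x.
have w0 x : 0 <= w x by rewrite adde_ge0.
have mw : measurable_fun setT w by exact: emeasurable_funD.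
have WW : \int[mu]_x (W x * W x) <= (16 * (cphi * M) * Y)%:E.
  rewrite EFinM -hY -ge0_integralZl_EFin //; last by rewrite mulr_ge0 // mulr_ge0.
  apply: ge0_le_integral => //.
  - by move=> x _; rewrite mule_ge0.
  - exact: emeasurable_funM.
  - exact: emeasurable_funM.
  by move=> x _; apply: sum_scale_mine_sqr_le => //; rewrite mulr_ge0.
have SS : \int[mu]_x (S x * S x) <= (C2 * (16 * (cphi * M) * Y))%:E.
  apply: (le_trans (square_function_le _ _ _ _)) => //.
    by apply: le_lt_trans WW _; rewrite ltry.
  by rewrite [leRHS]EFinM; apply: lee_wpmul2l.
have mff : measurable_fun setT (fun x => (f x ^+ 2)%:E).
  by apply/measurable_EFinP; apply: measurable_funX; case: bf.
have muu : measurable_fun setT (fun x => (enorm (grad f x) ^+ 2)%:E).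
  by apply/measurable_EFinP; apply: measurable_funX; apply/measurable_EFinP; exact: mu_u.
have ww : \int[mu]_x (w x * w x) <= 2%:E.
  apply: (@le_trans _ _ (\int[mu]_x (2%:E * ((f x ^+ 2)%:E + (enorm (grad f x) ^+ 2)%:E)))).
    apply: ge0_le_integral => //.
    - by move=> x _; rewrite mule_ge0.
    - exact: emeasurable_funM.
    - by apply: emeasurable_funM => //; exact: emeasurable_funD.
    move=> x _; rewrite /w /af /u -!EFinD -!EFinM lee_fin -(real_normK (num_real (f x))).
    set a := `|f x|%R; set d := enorm _.
    by have := sqr_ge0 (a - d)%R; rewrite !expr2; nra.
  rewrite ge0_integralZl_EFin //; last 2 first.
  - by move=> x _; rewrite adde_ge0 // lee_fin sqr_ge0.
  - exact: emeasurable_funD.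
  rewrite ge0_integralD //; last 2 first.
  - by move=> x _; rewrite lee_fin sqr_ge0.
  - by move=> x _; rewrite lee_fin sqr_ge0.
  by rewrite -[leRHS]mule1; apply: lee_wpmul2l.
apply: (le_trans (sum_le k)); rewrite EFinM; apply: lee_wpmul2l => //.
have mwS : measurable_fun setT (fun x => w x * S x) by exact: emeasurable_funM.
apply: (@le_trans _ _ (\int[mu]_x (w x * S x))).
  have m1 : measurable_fun setT (fun x => af x * X 0%N x) by exact: emeasurable_funM.
  have m2 i : measurable_fun setT (fun x => u x * X i x) by exact: emeasurable_funM.
  have m3 : measurable_fun setT (fun x => \sum_(i < k) u x * X i x) by exact: emeasurable_sum.
  rewrite -ge0_integral_sum //; last by move=> i x _; rewrite mule_ge0.
  rewrite -ge0_integralD //; last 2 first.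
  - by move=> x _; rewrite mule_ge0.
  - by move=> x _; rewrite sume_ge0 // => i _; rewrite mule_ge0.
  apply: ge0_le_integral => //.
  - by move=> x _; apply: adde_ge0; [rewrite mule_ge0|apply: sume_ge0 => i _; rewrite mule_ge0].
  - exact: emeasurable_funD.
  move=> x _; rewrite /w ge0_muleDl //; apply: leeD.
    apply: lee_wpmul2l => //; rewrite /S /Sfun big_ord_recl leeDl //.
    by apply: sume_ge0 => i _; exact: X0.
  rewrite -ge0_sume_distrr //; apply: lee_wpmul2l => //.
  by rewrite /S /Sfun big_ord_recr /= leeDl //; exact: X0.
apply: (@le_trans _ _ (\int[mu]_x (l%:E * (w x * w x) + l^-1%:E * (S x * S x)))).
  apply: ge0_le_integral => //.
  - by move=> x _; rewrite mule_ge0.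
  - by apply: emeasurable_funD; apply: emeasurable_funM => //; exact: emeasurable_funM.
  by move=> x _; exact: mule_le_sqrD.
have ms : measurable_fun setT (fun x => S x * S x) by exact: emeasurable_funM.
have mww : measurable_fun setT (fun x => w x * w x) by exact: emeasurable_funM.
have w1 x : setT x -> 0 <= w x * w x by rewrite mule_ge0.
have S1 x : setT x -> 0 <= S x * S x by rewrite mule_ge0.
rewrite ge0_integralD //; last 4 first.
- by move=> x _; rewrite mule_ge0 ?w1 // lee_fin ltW.
- exact: emeasurable_funM.
- by move=> x _; rewrite mule_ge0 ?S1.
- exact: emeasurable_funM.
rewrite (ge0_integralZl_EFin mu measurableT w1 mww (ltW l0)).
rewrite (ge0_integralZl_EFin mu measurableT S1 ms li0).
rewrite EFinD; apply: leeD.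
  by rewrite mulrC EFinM; apply: lee_wpmul2l => //; rewrite lee_fin ltW.
by rewrite EFinM; apply: lee_wpmul2l => //; rewrite lee_fin.
Qed.

(** Dominated convergence: the double mollifications are uniformly bounded because [f] is, so a
    multiple of |g| dominates. Their limit (int phi)^2 f explains the factor on the left. *)
Lemma pairing_limit_le (l Y : R) : continuous f -> (0 < l)%R -> \int[mu]_x h x = Y%:E ->
  \int[mu]_x (f x ^+ 2)%:E + \int[mu]_x (enorm (grad f x) ^+ 2)%:E <= 1 ->
  ((\int[mu]_y phi y)%R ^+ 2)%:E * `|J f| <=
  (C1 * (2 * l + l^-1 * (C2 * (16 * (cphi * M) * Y))))%:E.
Proof.
move=> cnf l0 hY f1.
set c := (\int[mu]_y phi y)%R.
have [mf [B fB]] := bf.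
have mg : measurable_fun setT g by apply/measurable_EFinP; exact: measurable_int ig.
have bPP k : bdd_meas (P k (P k f)) by apply: bdd_meas_mollify => //; exact: bdd_meas_mollify.
pose L := (cphi * 2 ^+ n)%R.
have PB k x : (`|P k (P k f) x| <= L * (L * B))%R.
  apply: (mollify_le mphi phib); first exact: bdd_meas_mollify.
  by move=> y; exact: (mollify_le mphi phib).
have [_ _ H] := @dominated_convergence _ E R mu setT measurableT
  (fun k x => (P k (P k f) x * g x)%:E) (fun x => (c ^+ 2 * f x * g x)%:E)
  (fun x => (L * (L * B))%:E * `|(g x)%:E|)
  (fun k => measurable_int mu (integrable_bddM (bPP k) ig))
  ltac:(by apply/measurable_EFinP; apply: measurable_funM => //; apply: measurable_funM)
  ltac:(by apply: aeW => x _; apply: cvg_EFin; [exact: nearW|apply: cvgM; [exact: (mollify2_cvg mphi phib)|exact: cvg_cst]])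
  ltac:(by apply: integrableZl => //; exact: integrable_abse)
  ltac:(by apply: aeW => x k _; rewrite EFinM abseM lee_wpmul2r // lee_fin).
have {}H := @cvg_abse _ _ eventually_filter _ _ _ H.
have -> : (c ^+ 2)%:E * `|J f| = `|\int[mu]_x (c ^+ 2 * f x * g x)%:E|.
  under eq_integral do rewrite -mulrA EFinM.
  rewrite integralZl //; last exact: integrable_bddM.
  by rewrite abseM /= ger0_norm // sqr_ge0.
rewrite -(cvg_lim (@ereal_hausdorff R) H); apply: lime_le; first by apply/cvg_ex; eexists; exact: H.
by apply: nearW => k; exact: mollified_pairing_le.
Qed.

End duality_estimate.

(** * Test functions supported in [K] *)

Section test_functions.
Context {R : realType} {n : nat}.
Local Notation E := 'rV[R]_n.
Local Notation mu := (lebesgue_rV R n).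

Lemma supp_eq0 (f : E -> R) x : ~ supp f x -> f x = 0.
Proof. by move=> fx; apply: contrapT => /eqP f0; apply: fx; exact: subset_closure. Qed.

Lemma grad_eq0 (f : E -> R) x : ~ supp f x -> grad f x = 0.
Proof.
move=> fx; apply/rowP => i; rewrite !mxE /partial.
have -> : 'D_(delta_mx ord0 i) f x = 'D_(delta_mx ord0 i) (cst 0 : E -> R) x.
  apply: near_eq_derive.
  have : nbhs x (~` supp f).
    by apply: open_nbhs_nbhs; split => //; apply: closed_openC; exact: closed_closure.
  by apply: filterS => y; exact: supp_eq0.
exact: derive_cst.
Qed.

Lemma enorm0 : enorm (0 : E) = 0.
Proof.
by rewrite /enorm big1 ?sqrtr0 // => i _; rewrite mxE expr0n.
Qed.

Lemma integral_supp (K : set E) (F : E -> \bar R) : (forall x, ~ K x -> F x = 0%E) ->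
  (\int[mu]_(x in K) F x = \int[mu]_x F x)%E.
Proof.
move=> FK; rewrite integral_mkcond; congr (integral _ _ _); apply/funext => x.
by rewrite patchE; case: ifPn => // /negP xK; rewrite FK // => Kx; apply: xK; rewrite inE.
Qed.

(** [f] and its gradient vanish off [K], so the integrals extend to the whole space, where the
    mollification estimates take place; a square root at most 1 has its argument at most 1. *)
Lemma W12_norm_le1 (K : set E) (f : E -> R) : supp f `<=` K -> (W12_norm K f <= 1)%E ->
  (\int[mu]_x (f x ^+ 2)%:E + \int[mu]_x (enorm (grad f x) ^+ 2)%:E <= 1)%E.
Proof.
move=> fK; rewrite /W12_norm (@integral_supp K (fun x => (f x ^+ 2)%:E)); last first.
  by move=> x Kx; rewrite supp_eq0 ?expr0n // => /fK.
rewrite (@integral_supp K (fun x => (enorm (grad f x) ^+ 2)%:E)); last first.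
  by move=> x Kx; rewrite grad_eq0 ?enorm0 ?expr0n // => /fK.
have : (0 <= \int[mu]_x (f x ^+ 2)%:E + \int[mu]_x (enorm (grad f x) ^+ 2)%:E)%E.
  by apply: adde_ge0; apply: integral_ge0 => x _; rewrite lee_fin sqr_ge0.
case: (_ + _)%E => [a| |] //.
  rewrite lee_fin => a0; rewrite poweR_EFin !lee_fin powR12_sqrt // => a1.
  by rewrite -(sqr_sqrtr a0) expr_le1 // sqrtr_ge0.
by rewrite poweRE invr_eq0 pnatr_eq0.
Qed.

End test_functions.

(** * Choice of the free parameter and conclusion *)

Lemma le_sqrt_of_forall (R : realType) (a C K N : R) : 0 <= C -> 0 <= N ->
  (forall l, 0 < l -> a <= C * (2 * l + l^-1 * (K * N))) ->
  a <= C * (2 + K) * Num.sqrt N.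
Proof.
move=> C0; rewrite le_eqVlt => /predU1P[<- H|N0 H].
  (* For N = 0 the parameter has to tend to 0: l = e / (2 C + 1) makes the bound at most e, the
     summand 1 covering C = 0. *)
  rewrite sqrtr0 mulr0; apply/ler_addgt0Pr => e e0; rewrite add0r.
  have d0 : 0 < 2 * C + 1 by rewrite ltr_wpDl // mulr_ge0.
  apply: (le_trans (H (e / (2 * C + 1)) _)); first by rewrite divr_gt0.
  rewrite !mulr0 addr0 (_ : C * _ = e * ((2 * C) / (2 * C + 1))); last first.
    by field; rewrite gt_eqF.
  by rewrite -[leRHS]mulr1 ler_wpM2l ?(ltW e0) // ler_pdivrMr // mul1r lerDl.
(* l = sqrt N balances the two terms, which become (2 + K) sqrt N. *)
have s0 : 0 < Num.sqrt N by rewrite sqrtr_gt0.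
apply: (le_trans (H _ s0)); rewrite -mulrA ler_wpM2l //.
rewrite -[in X in K * X](sqr_sqrtr (ltW N0)) expr2.
by rewrite (_ : (Num.sqrt N)^-1 * (K * (Num.sqrt N * Num.sqrt N)) = K * Num.sqrt N) ?mulrDl //;
  field; rewrite gt_eqF.
Qed.

Theorem corollary1p8 (R : realType) (n : nat) (hn : (2 <= n)%N)
    (phi : 'rV[R]_n -> R) (hphi : mollifier phi)
    (K : set 'rV[R]_n) (hK : compact K) :
  exists C : R, forall g : 'rV[R]_n -> R, local_hardy phi g -> morrey g ->
    (Hm1_norm K g <=
     C%:E * (morrey_norm g `^ 2^-1) * (local_hardy_norm phi g `^ 2^-1))%E.
Proof.
pose mu := lebesgue_rV R n.
have [hC sball _ cne0] := hphi.
have [mphi [B phiB]] := Ccinfty_bdd_meas hC.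
have phi_ball y : phi y != 0 -> enorm y < 1.
  move=> py; have /sball : supp phi y by exact: subset_closure.
  by rewrite /eball /= subr0.
(* The support lies in the unit ball, hence in the unit cube on which the mollification estimates
   are set. *)
have phib y : `|phi y| <= B * \1_(cube 1) y.
  have B0 : 0 <= B := le_trans (normr_ge0 _) (phiB y).
  have [->|py] := eqVneq (phi y) 0; first by rewrite normr0 mulr_ge0.
  rewrite indicE mem_set ?mulr1 // => i.
  exact: le_lt_trans (normr_le_enorm y i) (phi_ball y py).
have B0 := cphi_ge0 phib.
set c := \int[mu]_y phi y.
have c0 : 0 < c ^+ 2.
  rewrite exprn_even_gt0 //=; apply: contra cne0 => /eqP c0.
  have ip : mu.-integrable setT (EFin \o phi).
    apply: eq_integrable (integrable_phiM mphi phib (G := fun=> 1) _) => //.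
      by move=> y _; rewrite mulr1.
    by split; [exact: measurable_cst|exists 1; rewrite normr1].
  by rewrite -(fineK (integrable_fin_num measurableT ip)) -/(Rintegral mu setT phi) -/c c0.
pose C1 := @duality_cst R n B; pose C2 := @square_cst R n * (16 * B).
have C10 : 0 <= C1 by rewrite /C1 /duality_cst addr_ge0 ?mulr_ge0 // exprn_ge0.
(* The division undoes the factor (int phi)^2 left by the limit of the double mollifications. In
   [C2] the factor 16 B comes from W^2 <= 16 c M h with c = B. *)
exists (C1 * (2 + C2) / c ^+ 2) => g [ig ih] [_ gMoo].
have mh := measurable_int mu ih.
have M0 : (0 <= morrey_norm g)%E.
  apply: (@le_trans _ _ ((1 ^ (2%:Z - n%:Z))%:E * \int[mu]_(y in eball 0 1) `|g y|%:E)%E).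
    by rewrite exp1rz mul1e; apply: integral_ge0 => x _; rewrite lee_fin.
  by apply: ereal_sup_ubound; exists 0 => //; exists 1 => //=; exact: ltr01.
have hE : (local_hardy_norm phi g = \int[mu]_x local_maximal phi g x)%E.
  rewrite /local_hardy_norm Lnorm1; apply: eq_integral => x _.
  by rewrite gee0_abs // local_maximal_ge0.
have Yfin : (local_hardy_norm phi g \is a fin_num).
  by rewrite hE; exact: integrable_fin_num.
have Y0 : (0 <= local_hardy_norm phi g)%E.
  by rewrite hE; apply: integral_ge0 => x _; exact: local_maximal_ge0.
have Mfin : morrey_norm g \is a fin_num by rewrite ge0_fin_numE.
(* Both norms are finite, so the powers 1/2 are real square roots and merge into sqrt (M Y), the
   shape produced by optimizing over l. *)
move: M0 Y0; rewrite -(fineK Mfin) -(fineK Yfin) !lee_fin => M0 Y0.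
rewrite !poweR_EFin !powR12_sqrt // -!EFinM -[X in X%:E]mulrA -sqrtrM //.
set M := fine (morrey_norm g) in M0 *; set Y := fine (local_hardy_norm phi g) in Y0 *.
apply: ge_ereal_sup => _ [f [hf fK f1] <-].
have [sf _] := hf.
have [cf df1] := sf [::].
rewrite (@integral_supp _ _ K (fun x => (g x * f x)%:E)); last by move=> x Kx; rewrite (@supp_eq0 _ _ f) ?mulr0 // => /fK.
have {}f1 := W12_norm_le1 fK f1.
have hY : (\int[mu]_x local_maximal phi g x = Y%:E)%E by rewrite -hE fineK.
have bf := Ccinfty_bdd_meas hf.
have ifg := integrable_bddM bf ig.
have H l : 0 < l -> ((c ^+ 2)%:E * `|\int[mu]_x (f x * g x)%:E| <=
    (C1 * (2 * l + l^-1 * (C2 * (M * Y))))%:E)%E.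
  move=> l0; apply: le_trans (pairing_limit_le mphi phib phi_ball ig mh M0 (esym (fineK Mfin))
    bf (fun i x => df1 x i) (fun i => proj1 (sf [:: i])) cf l0 hY f1) _.
  rewrite lee_fin le_eqVlt; apply/orP; left; apply/eqP; rewrite /C1 /C2.
  by congr (_ * (_ + _ * _)); ring.
under eq_integral do rewrite mulrC.
apply: le_trans (lee_abs _) _.
move: H; rewrite -(fineK (integrable_fin_num measurableT ifg)).
set a := fine _ => H.
rewrite abse_EFin lee_fin [_ / _ * _]mulrAC ler_pdivlMr // mulrC.
by apply: le_sqrt_of_forall => //; exact: mulr_ge0.
Qed.
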